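(* (1) The functors $\mathscr C:\mathbf{Nach}\to\mathbf{nbal}$ and $\mathscr X:\mathbf{nbal}\to\mathbf{Nach}$ form a contravariant adjunction with units $\phi:1_{\mathbf{nbal}}\to\mathscr C\mathscr X$ and $\eta:1_{\mathbf{Nach}}\to\mathscr X\mathscr C$ such that $\eta$ is a natural isomorphism. (2) The functors $\mathscr C_\le:\mathbf{Nach}\to\mathbf{sbal}$ and $\mathscr Y:\mathbf{sbal}\to\mathbf{Nach}$ form a contravariant adjunction with units $\psi:1_{\mathbf{sbal}}\to\mathscr C_\le\mathscr Y$ and $\zeta:1_{\mathbf{Nach}}\to\mathscr Y\mathscr C_\le$ such that $\zeta$ is a natural isomorphism.
   Context: **Nachbin spaces.** A Nachbin space is a compact topological space $X$ with a partial order $\le$ that is closed in $X\times X$. $\mathbf{Nach}$ is the category of Nachbin spaces and continuous order-preserving maps. $C(X)$ is the algebra of continuous real-valued functions on $X$, $C_\le(X)=\{f\in C(X): f\text{ is order preserving}\}$, and $f\prec_X g$ iff there is $c\in C_\le(X)$ with $f\le c\le g$. **bal-algebras.** All rings are commutative with $1$ and ring homomorphisms are unital. An $\ell$-ring is a ring $A$ with a lattice order such that $a\le b$ implies $a+c\le b+c$, and $0\le a,b$ implies $0\le ab$. It is bounded if for each $a$ there is $n\in\mathbb N$ with $-n\cdot1\le a\le n\cdot1$, and archimedean if whenever $na\le b$ for all $n\in\mathbb N$, then $a\le0$. An $\ell$-algebra is an $\ell$-ring that is an $\mathbb R$-algebra with $ra\ge0$ whenever $0\le a\in A$ and $0\le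 r\in\mathbb R$. $\mathbf{bal}$ is the category of bounded archimedean $\ell$-algebras and unital $\ell$-algebra homomorphisms; $r\in\mathbb R$ is identified with $r\cdot1\in A$. Put $|a|=a\vee(-a)$ and $\|a\|=\inf\{r\in\mathbb R:|a|\le r\}$ (the uniform norm). $\mathbb R^+=[0,\infty)$. **Proximities.** A reflexive proximity on $A\in\mathbf{bal}$ is a binary relation $\prec$ such that: (P1) $a\prec b$ implies $a\le b$; (P2) $a\le b\prec c\le d$ implies $a\prec d$; (P3) $a\prec b,c$ implies $a\prec b\wedge c$; (P4) $a,b\prec c$ implies $a\vee b\prec c$; (RP5) $a\prec b$ implies there is $c$ with $a\prec c\prec c\prec b$; (P6) $a\prec b$ and $c\prec d$ imply $a+c\prec b+d$; (P7) if $0\le a,b,c,d$, $a\prec b$ and $c\prec d$, then $ac\prec bd$; (P8) $r\prec r$ for $r\in\mathbb R$; (P9) $a\prec b$ and $r\in\mathbb R^+$ imply $ra\prec rb$. Put $\mathscr R(A,\prec)=\{c\in A:c\prec c\}$. $\mathbf{nbal}$ is the category of pairs $(A,\prec)$ with $A\in\mathbf{bal}$ and $\prec$ a reflexive proximity on $A$ such that $\{c-d:c,d\in\mathscr R(A,\prec)\}$ is uniformly dense in $A$; morphisms are the $\mathbf{bal}$-morphisms $\alpha$ such that $a\prec b$ implies $\alpha(a)\prec\alpha(b)$. **sbal-algebras.** An $\ell$-monoid is a commutative monoid $(S,+,0)$ with a lattice order such that $a\le b\iff a+c\le b+c$, $(a\vee b)+c=(a+c)\vee(b+c)$ and $(a\wedge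 b)+c=(a+c)\wedge(b+c)$. An $\ell$-monoid morphism is a lattice morphism preserving addition. Let $S^+=\{a\in S:a\ge0\}$. An $\ell$-monoid $S$ is an $\ell$-semialgebra if there is a commutative associative multiplication on $S^+$ with identity $1$; $a(b+c)=ab+ac$ for $a,b,c\in S^+$; $a\le b$ implies $ac\le bc$ for $a,b,c\in S^+$; and there is a unital $\ell$-monoid morphism $\rho:\mathbb R\to S$ preserving multiplication. We write $r$ for $\rho(r)$ and $a-r$ for $a+\rho(-r)$. $S$ is bounded if for each $a$ there is $r\in\mathbb R^+$ with $-r\le a\le r$, and archimedean if for all $a,b,c,d\in S$, $na+b\le nc+d$ for all $n\in\mathbb N$ implies $a\le c$. The $\mathbb R^+$-action is $ra=\rho(r)a$ for $a\in S^+$, and $ra=r(a+s)-rs$ for general $a$, where $s\in\mathbb R^+$ is any element with $a+s\ge0$. $\mathbf{sbal}$ is the category of bounded archimedean $\ell$-semialgebras, with morphisms the unital $\ell$-monoid morphisms preserving multiplication on positive cones and the $\mathbb R^+$-action. **The envelope.** For $S\in\mathbf{sbal}$, $\mathscr BS$ is the quotient of $S\times S$ by $(a,b)\sim(c,d)\iff a+d=b+c$, with classes $[a,b]$ (each representable with $a,b\ge0$), $[a,b]+[c,d]=[a+c,b+d]$, $[a,b][c,d]=[ac+bd,ad+bc]$ for $a,b,c,d\ge0$, $r[a,b]=[ra,rb]$ and $-r[a,b]=r[b,a]$ for $r\in\mathbb R^+$, and $[a,b]\le[c,d]\iff a+d\le b+c$. With $\varepsilon_S(a)=[a,0]$, $\mathscr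 BS$ carries the proximity $x\prec_S y\iff\exists s\in S:\ x\le\varepsilon_S(s)\le y$; on morphisms $\mathscr B\alpha[a,b]=[\alpha(a),\alpha(b)]$. **Functors.** An ideal $I$ of $A\in\mathbf{bal}$ is an $\ell$-ideal if $|a|\le|b|$, $b\in I$ imply $a\in I$. $X_A$ is the space of maximal $\ell$-ideals of $A$ with closed sets $\{x\in X_A:I\subseteq x\}$, $I$ an $\ell$-ideal. For $(A,\prec)\in\mathbf{nbal}$ and $y\in X_A$ let ${\Downarrow}y=\{a\in A:\exists c\in y\cap\mathscr R(A,\prec),\ c\ge0,\ |a|\le c\}$ and define $x\le y\iff{\Downarrow}y\subseteq x$. $\mathscr X(A,\prec)=(X_A,\le)$ and $\mathscr X\alpha=\alpha^{-1}$. $\mathscr C X=(C(X),\prec_X)$, $\mathscr C_\le X=C_\le(X)$, both sending $\varphi$ to $f\mapsto f\circ\varphi$. $\mathscr Y=\mathscr X\mathscr B$. **Units.** $\phi_A:A\to C(X_A)$ is given by $\phi_A(a)(x)=r$, the unique real with $a+x=r+x$ in $A/x\cong\mathbb R$. $\eta_X:X\to X_{C(X)}$ is $\eta_X(x)=M_x=\{f\in C(X):f(x)=0\}$. $\psi_S=\phi_{\mathscr BS}\circ\varepsilon_S:S\to C_\le(\mathscr YS)$. $\zeta_X=\mathscr X\iota_{C(X)}\circ\eta_X$, where $\iota_{C(X)}$ is the inclusion into $C(X)$ of $\mathscr BC_\le(X)=\{f-g:f,g\in C_\le(X)\}$; i.e. $\zeta_X(x)=M_x\cap\mathscr BC_\le(X)$.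 *)

(* Defs.v *)
From HB Require Import structures.
From mathcomp Require Import all_boot all_order all_algebra.
From mathcomp Require Import ring lra.
From mathcomp Require Import all_classical all_reals topology normedtype.

Set Implicit Arguments.
Unset Strict Implicit.
Unset Printing Implicit Defensive.

Import Order.TTheory GRing.Theory Num.Theory.
Import numFieldNormedType.Exports.

Local Open Scope classical_set_scope.
Local Open Scope ring_scope.

Record category := Category {
  ob :> Type;
  hom : ob -> ob -> Type;
  idm : forall x, hom x x;
  compm : forall x y z, hom y z -> hom x y -> hom x z;
  compmA : forall w x y z (h : hom y z) (g : hom x y) (f : hom w x),
    compm h (compm g f) = compm (compm h g) f;
  comp1m : forall x y (f : hom x y), compm (idm y) f = f;
  compm1 : forall x y (f : hom x y), compm f (idm x) = f
}.
Arguments idm {c} x.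
Arguments compm {c x y z} g f : rename.

Record contrafunctor (C D : category) (F : C -> D) := Contrafunctor {
  fmap :> forall x y : C, hom x y -> hom (F y) (F x);
  fmap_id : forall x : C, fmap (idm x) = idm (F x);
  fmap_comp : forall (x y z : C) (g : hom y z) (f : hom x y),
    fmap (compm g f) = compm (fmap f) (fmap g)
}.

(* Contravariant functors F : C -> D and G : D -> C that are adjoint on the
   right, with units u : 1 -> F G and v : 1 -> G F. *)
Definition contravariant_adjunction (C D : category) (Fo : C -> D) (Go : D -> C)
    (F : contrafunctor Fo) (G : contrafunctor Go)
    (u : forall d : D, hom d (Fo (Go d))) (v : forall c : C, hom c (Go (Fo c))) :=
  [/\ forall (d d' : D) (f : hom d d'),
        compm (u d') f = compm (F _ _ (G _ _ f)) (u d),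
      forall (c c' : C) (f : hom c c'),
        compm (v c') f = compm (G _ _ (F _ _ f)) (v c),
      forall c : C, compm (F _ _ (v c)) (u (Fo c)) = idm (Fo c)
    & forall d : D, compm (G _ _ (u d)) (v (Go d)) = idm (Go d)].

Definition is_iso (C : category) (x y : C) (f : hom x y) :=
  exists g : hom y x, compm g f = idm x /\ compm f g = idm y.

Definition nachbin_axioms (X : topologicalType) (le : X -> X -> Prop) :=
  [/\ compact [set: X],
      forall x, le x x,
      forall x y, le x y -> le y x -> x = y,
      forall x y z, le x y -> le y z -> le x z
    & closed [set p : X * X | le p.1 p.2]].

Record nach := Nach {
  nach_space :> topologicalType;
  nach_le : nach_space -> nach_space -> Prop;
  nach_ax : nachbin_axioms nach_le
}.
Arguments nach_le {n} x y : rename.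

Record nach_hom (X Y : nach) := NachHom {
  nach_fun :> X -> Y;
  nach_fun_continuous : continuous nach_fun;
  nach_fun_homo : forall x y, nach_le x y -> nach_le (nach_fun x) (nach_fun y)
}.

Arguments nach_fun_continuous {X Y} n : rename.

Lemma nach_hom_ext (X Y : nach) (f g : nach_hom X Y) : f =1 g -> f = g.
Proof.
case: f g => [f cf hf] [g cg hg] /= /funext fg; subst g.
by congr NachHom; exact: Prop_irrelevance.
Qed.

Definition nach_id (X : nach) : nach_hom X X :=
  @NachHom X X id (fun x => @cvg_id X (nbhs x)) (fun _ _ h => h).

Fact nach_comp_subproof (X Y Z : nach) (g : nach_hom Y Z) (f : nach_hom X Y) :
  continuous (g \o f).
Proof. by move=> x; apply: continuous_comp; apply: nach_fun_continuous. Qed.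

Definition nach_comp (X Y Z : nach) (g : nach_hom Y Z) (f : nach_hom X Y) :
    nach_hom X Z :=
  @NachHom X Z (g \o f) (@nach_comp_subproof X Y Z g f)
    (fun _ _ h => nach_fun_homo g (nach_fun_homo f h)).

Definition Nachcat : category.
Proof.
by apply: (@Category nach nach_hom nach_id nach_comp) => *; exact: nach_hom_ext.
Defined.

(* A commutative R-algebra with a lattice order, without any compatibility
   between the two.  Bounded archimedean l-algebras are singled out by bal_axioms
   below.  Spectra are defined at this level of generality because they are also
   applied to envelopes of semialgebras: the axioms of a bounded archimedean
   l-semialgebra do not force products of positive elements of its envelope to
   be positive.  The trivial ring is allowed, it is the algebra of continuous
   functions on the empty space.  The module and lattice structures are raw
   fields, turned into instances of the library structures just below. *)
HB.mixin Record isLatAlg (R : realType) A of GRing.ComPzRing A := {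
  la_scale : R -> A -> A;
  la_le : rel A;
  la_meet : A -> A -> A;
  la_join : A -> A -> A;
  la_scalerA : forall r s a, la_scale r (la_scale s a) = la_scale (r * s) a;
  la_scale1r : forall a, la_scale 1 a = a;
  la_scalerDr : forall r a b,
    la_scale r (a + b) = la_scale r a + la_scale r b;
  la_scalerDl : forall r s a,
    la_scale (r + s) a = la_scale r a + la_scale s a;
  la_scalerAl : forall r a b, la_scale r (a * b) = la_scale r a * b;
  la_le_refl : reflexive la_le;
  la_le_anti : antisymmetric la_le;
  la_le_trans : transitive la_le;
  la_lexI : forall a b c, la_le a (la_meet b c) = la_le a b && la_le a c;
  la_leUx : forall a b c, la_le (la_join a b) c = la_le a c && la_le b c
}.

#[short(type="latAlgType")]
HB.structure Definition LatAlg (R : realType) :=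
  { A of isLatAlg R A & GRing.ComPzRing A }.

Section LatAlgInstances.
Variables (R : realType) (A : latAlgType R).

Fact la_scalerDl_morph (a : A) : {morph (@la_scale R A)^~ a : r s / r + s}.
Proof. by move=> r s; exact: la_scalerDl. Qed.

HB.instance Definition _ := @GRing.Zmodule_isLmodule.Build R A (@la_scale R A)
  (@la_scalerA R A) (@la_scale1r R A) (@la_scalerDr R A) la_scalerDl_morph.
HB.instance Definition _ := Order.Le_isPOrder.Build ring_display A
  (@la_le_refl R A) (@la_le_anti R A) (@la_le_trans R A).
HB.instance Definition _ := Order.POrder_MeetJoin_isLattice.Build ring_display A
  (@la_lexI R A) (@la_leUx R A).

End LatAlgInstances.

(* The real r seen as the element r.1 of A. *)
Definition scal (R : realType) (A : latAlgType R) (r : R) : A := r *: (1 : A).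

Record bal_axioms (R : realType) (A : latAlgType R) : Prop := BalAxioms {
  bal_lerD2r : forall a b c : A, a <= b -> a + c <= b + c;
  bal_mulr_ge0 : forall a b : A, 0 <= a -> 0 <= b -> 0 <= a * b;
  bal_scaler_ge0 : forall (r : R) (a : A), 0 <= r -> 0 <= a -> 0 <= r *: a;
  bal_bounded : forall a : A, exists n : nat, (- n%:R : A) <= a <= n%:R;
  bal_archimedean : forall a b : A, (forall n : nat, a *+ n <= b) -> a <= 0
}.

Record bal (R : realType) := Bal {
  bal_alg :> latAlgType R;
  bal_ax : bal_axioms bal_alg
}.

Section Proximity.
Variables (R : realType) (A : latAlgType R).
Implicit Types (a b c d : A) (prec : A -> A -> Prop).

(* |a| = a v (- a) *)
Definition labs a : A := Order.join a (- a).

Definition unorm a : R := inf [set r : R | labs a <= scal A r].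

Record reflexive_proximity prec : Prop := ReflexiveProximity {
  prox_le : forall a b, prec a b -> a <= b;
  prox_le_trans : forall a b c d, a <= b -> prec b c -> c <= d -> prec a d;
  prox_meet : forall a b c, prec a b -> prec a c -> prec a (Order.meet b c);
  prox_join : forall a b c, prec a c -> prec b c -> prec (Order.join a b) c;
  prox_refl_interp : forall a b, prec a b ->
    exists c, [/\ prec a c, prec c c & prec c b];
  prox_add : forall a b c d, prec a b -> prec c d -> prec (a + c) (b + d);
  prox_mul : forall a b c d, 0 <= a -> 0 <= b -> 0 <= c -> 0 <= d ->
    prec a b -> prec c d -> prec (a * c) (b * d);
  prox_scalar : forall r : R, prec (scal A r) (scal A r);
  prox_scale : forall a b (r : R), 0 <= r -> prec a b -> prec (r *: a) (r *: b)
}.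

Definition reflexives prec : set A := [set c | prec c c].

Definition nbal_axioms prec :=
  reflexive_proximity prec /\
  forall a (e : R), 0 < e -> exists c d,
    [/\ reflexives prec c, reflexives prec d & unorm (a - (c - d)) < e].

End Proximity.

Record nbal (R : realType) := Nbal {
  nbal_alg :> bal R;
  nbal_prec : nbal_alg -> nbal_alg -> Prop;
  nbal_ax : nbal_axioms nbal_prec
}.
Arguments nbal_prec {R n} a b : rename.

(* linear and monoid_morphism make f a unital R-algebra morphism. *)
Definition is_latalg_hom (R : realType) (A B : latAlgType R) (f : A -> B) :=
  [/\ linear f, monoid_morphism f, Order.meet_morphism f
    & Order.join_morphism f].

Record nbal_hom (R : realType) (A B : nbal R) := NbalHom {
  nbal_fun :> A -> B;
  nbal_fun_hom : is_latalg_hom nbal_fun;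
  nbal_fun_prec : forall a b,
    nbal_prec a b -> nbal_prec (nbal_fun a) (nbal_fun b)
}.

Section NbalCat.
Variable R : realType.

Lemma nbal_hom_ext (A B : nbal R) (f g : nbal_hom A B) : f =1 g -> f = g.
Proof.
case: f g => [f cf hf] [g cg hg] /= /funext fg; subst g.
by congr NbalHom; exact: Prop_irrelevance.
Qed.

Fact nbal_id_subproof (A : nbal R) : is_latalg_hom (@idfun A).
Proof. by []. Qed.

Definition nbal_id (A : nbal R) : nbal_hom A A :=
  @NbalHom R A A idfun (nbal_id_subproof A) (fun _ _ h => h).

Fact nbal_comp_subproof (A B C : nbal R) (g : nbal_hom B C) (f : nbal_hom A B) :
  is_latalg_hom (g \o f).
Proof.
case: f g => [f [f1 [f2 f2'] f3 f4] _] [g [g1 [g2 g2'] g3 g4] _] /=; split => /=.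
- by move=> r a b /=; rewrite f1 g1.
- by split => [|a b] /=; rewrite ?f2 ?g2 // f2' g2'.
- by move=> a b /=; rewrite f3 g3.
- by move=> a b /=; rewrite f4 g4.
Qed.

Definition nbal_comp (A B C : nbal R) (g : nbal_hom B C) (f : nbal_hom A B) :
    nbal_hom A C :=
  @NbalHom R A C (g \o f) (nbal_comp_subproof g f)
    (fun _ _ h => nbal_fun_prec g (nbal_fun_prec f h)).

Definition nbalcat : category.
Proof.
by apply: (@Category (nbal R) (@nbal_hom R) nbal_id nbal_comp) => *;
  exact: nbal_hom_ext.
Defined.

End NbalCat.

HB.mixin Record isLMonoid S of GRing.Nmodule S := {
  lm_le : rel S;
  lm_meet : S -> S -> S;
  lm_join : S -> S -> S;
  lm_le_refl : reflexive lm_le;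
  lm_le_anti : antisymmetric lm_le;
  lm_le_trans : transitive lm_le;
  lm_lexI : forall a b c, lm_le a (lm_meet b c) = lm_le a b && lm_le a c;
  lm_leUx : forall a b c, lm_le (lm_join a b) c = lm_le a c && lm_le b c;
  lm_leD2r : forall a b c, lm_le a b = lm_le (a + c) (b + c);
  lm_joinDl : forall a b c, lm_join a b + c = lm_join (a + c) (b + c);
  lm_meetDl : forall a b c, lm_meet a b + c = lm_meet (a + c) (b + c)
}.

#[short(type="lMonoidType")]
HB.structure Definition LMonoid := { S of isLMonoid S & GRing.Nmodule S }.

Section LMonoidInstances.
Variable S : lMonoidType.

HB.instance Definition _ := Order.Le_isPOrder.Build ring_display S
  (@lm_le_refl S) (@lm_le_anti S) (@lm_le_trans S).
HB.instance Definition _ := Order.POrder_MeetJoin_isLattice.Build ring_display S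
  (@lm_lexI S) (@lm_leUx S).

End LMonoidInstances.

Definition cone (S : lMonoidType) := {a : S | (0 : S) <= a}.

Section ConeNmodule.
Variable S : lMonoidType.
Implicit Types a b c : cone S.

HB.instance Definition _ := [isSub for (@sval S _ : cone S -> S)].
HB.instance Definition _ := [Choice of cone S by <:].

Lemma lm_lerD2r (a b c : S) : (a + c <= b + c) = (a <= b).
Proof. by rewrite [RHS](lm_leD2r _ _ c). Qed.

Lemma lm_addIr (c a b : S) : a + c = b + c -> a = b.
Proof.
move=> h; apply/le_anti.
by rewrite -(lm_lerD2r a b c) -(lm_lerD2r b a c) h lexx.
Qed.

Fact cone_add_subproof (a b : S) :
  (0 : S) <= a -> (0 : S) <= b -> (0 : S) <= a + b.
Proof.
by move=> a0 b0; apply: le_trans b0 _; rewrite -[leLHS]add0r lm_lerD2r.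
Qed.

Definition cone0 : cone S := exist _ 0 (lexx (0 : S)).
Definition cone_add a b : cone S :=
  exist _ (sval a + sval b) (cone_add_subproof (svalP a) (svalP b)).

Fact cone_addA : associative cone_add.
Proof. by move=> a b c; apply: val_inj; rewrite /= addrA. Qed.
Fact cone_addC : commutative cone_add.
Proof. by move=> a b; apply: val_inj; rewrite /= addrC. Qed.
Fact cone_add0 : left_id cone0 cone_add.
Proof. by move=> a; apply: val_inj; rewrite /= add0r. Qed.

HB.instance Definition _ :=
  GRing.isNmodule.Build (cone S) cone_addA cone_addC cone_add0.

End ConeNmodule.

Record lsemialg (R : realType) := LSemialg {
  lsa_monoid :> lMonoidType;
  cone_mul : cone lsa_monoid -> cone lsa_monoid -> cone lsa_monoid;
  cone_one : cone lsa_monoid;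
  rho : R -> lsa_monoid;
  cone_mulC : commutative cone_mul;
  cone_mulA : associative cone_mul;
  cone_mul1 : left_id cone_one cone_mul;
  cone_mulDr : right_distributive cone_mul +%R;
  cone_ler_mul : forall a b c,
    sval a <= sval b -> sval (cone_mul a c) <= sval (cone_mul b c);
  rho0 : rho 0 = 0;
  rhoD : {morph rho : r s / r + s};
  rho_meet : Order.meet_morphism rho;
  rho_join : Order.join_morphism rho;
  rho1 : rho 1 = sval cone_one;
  rhoM : forall (r s : R) a b, 0 <= r -> 0 <= s ->
    sval a = rho r -> sval b = rho s -> sval (cone_mul a b) = rho (r * s)
}.
Arguments cone_mul {R l} a b : rename.
Arguments cone_one {R l} : rename.
Arguments rho {R l} r : rename.

Record sbal (R : realType) := Sbal {
  sbal_alg :> lsemialg R;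
  sbal_bounded : forall a : sbal_alg, exists2 r : R,
    0 <= r & rho (- r) <= a <= rho r;
  sbal_archimedean : forall a b c d : sbal_alg,
    (forall n : nat, a *+ n + b <= c *+ n + d) -> a <= c
}.

Section ConeSemiring.
Variables (R : realType) (S : lsemialg R).
Implicit Types (a b c : cone S) (r s : R).

Fact cone_mul0 : left_zero 0 (@cone_mul R S).
Proof.
move=> a; apply: val_inj; apply: (@lm_addIr S (sval (cone_mul 0 a))).
by rewrite -[LHS]/(sval (cone_mul 0 a + cone_mul 0 a)) ![cone_mul 0 a]cone_mulC
  -cone_mulDr addr0 /= add0r.
Qed.

Fact cone_mulDl : left_distributive (@cone_mul R S) +%R.
Proof. by move=> a b c; rewrite ![cone_mul _ c]cone_mulC cone_mulDr. Qed.

HB.instance Definition _ := GRing.Nmodule_isComPzSemiRing.Build (cone S)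
  (@cone_mulA R S) (@cone_mulC R S) (@cone_mul1 R S) cone_mulDl cone_mul0.

Lemma rho_ge0 r : 0 <= r -> (0 : S) <= rho r.
Proof.
by move=> r0; apply/meet_idPl; rewrite -rho0 -rho_meet; congr rho; apply/meet_idPl.
Qed.

Fact rho_pos_subproof r : (0 : S) <= rho (Num.max r 0).
Proof. by apply: rho_ge0; rewrite le_max lexx orbT. Qed.

(* rho r as an element of the positive cone; only meaningful for 0 <= r. *)
Definition cone_rho r : cone S :=
  exist _ (rho (Num.max r 0)) (rho_pos_subproof r).

Lemma cone_rhoE r : 0 <= r -> sval (cone_rho r) = rho r.
Proof. by move=> r0; rewrite /= (elimT max_idPl). Qed.

(* Identity on the positive cone. *)
Definition to_cone (a : S) : cone S := insubd (0 : cone S) a.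

(* r a = rho(r) a for 0 <= a, and r a = r (a + s) - r s in general, for some
   0 <= s with 0 <= a + s; only meaningful for 0 <= r. *)
Definition act r (a : S) : S :=
  if (0 : S) <= a then sval (cone_rho r * to_cone a)
  else let s := xget 0 [set s : R | 0 <= s /\ (0 : S) <= a + rho s] in
       sval (cone_rho r * to_cone (a + rho s)) + rho (- (r * s)).

End ConeSemiring.

(* In sbal_funM, the elements a' and b' are f a and f b, which lie in the positive
   cone of T because f is a lattice morphism with f 0 = 0. *)
Record sbal_hom (R : realType) (S T : sbal R) := SbalHom {
  sbal_fun :> S -> T;
  sbal_fun0 : sbal_fun 0 = 0;
  sbal_funD : {morph sbal_fun : a b / a + b};
  sbal_funI : Order.meet_morphism sbal_fun;
  sbal_funU : Order.join_morphism sbal_fun;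
  sbal_fun1 : sbal_fun (rho 1) = rho 1;
  sbal_funM : forall (a b : cone S) (a' b' : cone T),
    sbal_fun (sval a) = sval a' -> sbal_fun (sval b) = sval b' ->
    sbal_fun (sval (a * b)) = sval (a' * b');
  sbal_fun_act : forall (r : R) (a : S), 0 <= r ->
    sbal_fun (act r a) = act r (sbal_fun a)
}.

Section SbalCat.
Variable R : realType.

Lemma sbal_hom_ext (S T : sbal R) (f g : sbal_hom S T) : f =1 g -> f = g.
Proof.
case: f g => [f ? ? ? ? ? ? ?] [g ? ? ? ? ? ? ?] /= /funext fg; subst g.
by congr SbalHom; exact: Prop_irrelevance.
Qed.

Lemma sbal_fun_ge0 (S T : sbal R) (f : sbal_hom S T) (a : S) :
  (0 : S) <= a -> (0 : T) <= f a.
Proof.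
move=> /meet_idPl a0; apply/meet_idPl.
by rewrite -[X in Order.meet X _](sbal_fun0 f) -sbal_funI a0 sbal_fun0.
Qed.

Definition sbal_id (S : sbal R) : sbal_hom S S.
Proof.
by apply: (@SbalHom R S S id) => // a b a' b' /val_inj-> /val_inj->.
Defined.

Definition sbal_comp (S T U : sbal R) (g : sbal_hom T U) (f : sbal_hom S T) :
  sbal_hom S U.
Proof.
apply: (@SbalHom R S U (g \o f)) => /=.
- by rewrite !sbal_fun0.
- by move=> a b /=; rewrite !sbal_funD.
- by move=> a b /=; rewrite !sbal_funI.
- by move=> a b /=; rewrite !sbal_funU.
- by rewrite !sbal_fun1.
- move=> a b a' b' ha hb.
  pose fa : cone T := exist _ (f (sval a)) (sbal_fun_ge0 f (svalP a)).
  pose fb : cone T := exist _ (f (sval b)) (sbal_fun_ge0 f (svalP b)).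
  rewrite (@sbal_funM _ _ _ f a b fa fb erefl erefl).
  exact: (@sbal_funM _ _ _ g fa fb a' b' ha hb).
- by move=> r a r0; rewrite !sbal_fun_act.
Defined.

Definition sbalcat : category.
Proof.
by apply: (@Category (sbal R) (@sbal_hom R) sbal_id sbal_comp) => *;
  exact: sbal_hom_ext.
Defined.

End SbalCat.
Section Envelope.
Variables (R : realType) (S : sbal R).
Local Open Scope quotient_scope.

(* Elements of the envelope are classes of pairs for (a, b) ~ (c, d) iff
   a + d = b + c; cl a b is the class [a, b].  All the operations are computed on
   the representatives env_rep x taken in the positive cone. *)
Definition env_rel (p q : S * S) := p.1 + q.2 == p.2 + q.1.

Fact env_rel_refl : reflexive env_rel.
Proof. by move=> p; rewrite /env_rel addrC. Qed.

Fact env_rel_sym : symmetric env_rel.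
Proof.
by move=> p q; rewrite /env_rel eq_sym [p.2 + _]addrC [p.1 + _]addrC.
Qed.

Fact env_rel_trans : transitive env_rel.
Proof.
move=> q p r /eqP h1 /eqP h2; apply/eqP; apply: (@lm_addIr S (q.1 + q.2)).
transitivity (p.1 + q.2 + (q.1 + r.2)).
  by rewrite [q.1 + r.2]addrC [RHS]addrACA [q.2 + q.1]addrC.
by rewrite h1 h2 [q.2 + _]addrC [LHS]addrACA.
Qed.

Canonical env_equiv := EquivRel env_rel env_rel_refl env_rel_sym env_rel_trans.

Definition env := {eq_quot env_equiv}.
HB.instance Definition _ := Choice.on env.

Definition cl (a b : S) : env := \pi_({eq_quot env_equiv}) (a, b).

Lemma clP (a b c d : S) : cl a b = cl c d <-> a + d = b + c.
Proof.
split=> [/(@eqmodP _ env_equiv)/eqP // | h].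
by apply/(@eqmodP _ env_equiv)/eqP.
Qed.

Definition ccl (a b : cone S) : env := cl (sval a) (sval b).

Lemma cclP (a b c d : cone S) : ccl a b = ccl c d <-> a + d = b + c.
Proof.
split; first by move=> /clP h; apply: val_inj.
by move=> h; apply/clP; rewrite -[LHS]/(sval (a + d)) h.
Qed.

Lemma cone_rhoD (r s : R) : 0 <= r -> 0 <= s ->
  cone_rho S (r + s) = cone_rho S r + cone_rho S s.
Proof.
move=> r0 s0; apply: val_inj; rewrite [LHS]cone_rhoE ?addr_ge0 //.
by rewrite rhoD [in RHS]/= -(cone_rhoE S r0) -(cone_rhoE S s0).
Qed.

Lemma cone_rhoM (r s : R) : 0 <= r -> 0 <= s ->
  cone_rho S (r * s) = cone_rho S r * cone_rho S s.
Proof.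
move=> r0 s0; apply: val_inj; rewrite [LHS]cone_rhoE ?mulr_ge0 //.
by rewrite -(@rhoM R S r s (cone_rho S r) (cone_rho S s)) // cone_rhoE.
Qed.

Lemma cone_rho1 : cone_rho S 1 = 1.
Proof. by apply: val_inj; rewrite [LHS]cone_rhoE // rho1. Qed.

Lemma cone_rho0 : cone_rho S 0 = 0.
Proof. by apply: val_inj; rewrite [LHS]cone_rhoE // rho0. Qed.

Lemma rho_oppK (r : R) : rho r + rho (- r) = 0 :> S.
Proof. by rewrite -rhoD subrr rho0. Qed.

Lemma shift_ge0 (a : S) : exists2 r, 0 <= r & (0 : S) <= a + rho r.
Proof.
have [r r0 /andP[h _]] := sbal_bounded a; exists r => //.
by rewrite -(rho_oppK (- r)) opprK lm_lerD2r.
Qed.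

Lemma env_ind (P : env -> Prop) :
  (forall a b : cone S, P (ccl a b)) -> forall x, P x.
Proof.
move=> h x; rewrite -[x]reprK; case: (repr x) => a b.
have [r r0 ha] := shift_ge0 a; have [s s0 hb] := shift_ge0 b.
have le0 (t : S) (u v : R) : 0 <= v -> (0 : S) <= t + rho u ->
    (0 : S) <= t + rho (u + v).
  move=> v0 t0; rewrite rhoD addrA; apply: le_trans t0 _.
  by rewrite -[leLHS]add0r [leRHS]addrC lm_lerD2r rho_ge0.
have h1 := le0 _ _ _ s0 ha; have h2 := le0 _ _ _ r0 hb.
have -> : \pi_({eq_quot env_equiv}) (a, b) = 
    ccl (exist _ (a + rho (r + s)) h1) (exist _ (b + rho (s + r)) h2).
  by apply/clP; rewrite /= [s + r]addrC addrCA.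
exact: h.
Qed.

(* A choice of representative in the positive cone. *)
Fact env_rep_subproof (x : env) : {p : cone S * cone S | ccl p.1 p.2 = x}.
Proof. by apply: cid; elim/env_ind: x => a b; exists (a, b). Qed.
Definition env_rep (x : env) := sval (env_rep_subproof x).
Lemma env_repP (x : env) : ccl (env_rep x).1 (env_rep x).2 = x.
Proof. exact: svalP (env_rep_subproof x). Qed.
Lemma env_rep_ccl (a b : cone S) :
  (env_rep (ccl a b)).1 + b = (env_rep (ccl a b)).2 + a.
Proof. exact/cclP/env_repP. Qed.

Definition env0 := ccl 0 0.
Definition env1 := ccl 1 0.
Definition env_opp x := let: (a, b) := env_rep x in ccl b a.
Definition env_add x y :=
  let: (a, b) := env_rep x in let: (c, d) := env_rep y in ccl (a + c) (b + d).
Definition env_mul x y :=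
  let: (a, b) := env_rep x in let: (c, d) := env_rep y in
  ccl (a * c + b * d) (a * d + b * c).
Definition env_le x y :=
  let: (a, b) := env_rep x in let: (c, d) := env_rep y in
  sval (a + d) <= sval (b + c).
Definition env_scale (r : R) x :=
  let: (a, b) := env_rep x in
  if 0 <= r then ccl (cone_rho S r * a) (cone_rho S r * b)
  else ccl (cone_rho S (- r) * b) (cone_rho S (- r) * a).

(* The lattice operations: [a, b] v [c, d] = [(a + d) v (b + c), b + d], and
   dually. *)
Definition env_join x y :=
  let: (a, b) := env_rep x in let: (c, d) := env_rep y in
  cl (Order.join (sval (a + d)) (sval (b + c))) (sval (b + d)).
Definition env_meet x y :=
  let: (a, b) := env_rep x in let: (c, d) := env_rep y in
  cl (Order.meet (sval (a + d)) (sval (b + c))) (sval (b + d)).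

Lemma coneIr (c a b : cone S) : a + c = b + c -> a = b.
Proof. by move=> /(congr1 sval)/lm_addIr h; apply: val_inj. Qed.

Lemma env_oppE a b : env_opp (ccl a b) = ccl b a.
Proof.
rewrite /env_opp; have := env_rep_ccl a b; case: (env_rep _) => a' b' /= h.
by apply/cclP; rewrite -h.
Qed.

Lemma env_addE a b c d : env_add (ccl a b) (ccl c d) = ccl (a + c) (b + d).
Proof.
rewrite /env_add; have := env_rep_ccl a b; case: (env_rep _) => a' b' /= h.
have := env_rep_ccl c d; case: (env_rep _) => c' d' /= k.
by apply/cclP; rewrite addrACA h k addrACA.
Qed.

Lemma env_mulE a b c d :
  env_mul (ccl a b) (ccl c d) = ccl (a * c + b * d) (a * d + b * c).
Proof.
rewrite /env_mul; have := env_rep_ccl a b; case: (env_rep _) => a' b' /= h.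
have := env_rep_ccl c d; case: (env_rep _) => c' d' /= k.
apply/cclP; apply: (@coneIr (a' * d + b' * c)).
have -> : a' * c' + b' * d' + (a * d + b * c) + (a' * d + b' * c) =
  a' * (c' + d) + b' * (d' + c) + (a * d + b * c) by ring.
transitivity (a' * (d' + c) + b' * (c' + d) + (a * d + b * c)).
  by rewrite k.
transitivity (a' * d' + b' * c' + ((a' + b) * c + (b' + a) * d)); first by ring.
transitivity (a' * d' + b' * c' + ((b' + a) * c + (a' + b) * d)); last by ring.
by rewrite h.
Qed.

Lemma cleD2r (c a b : cone S) :
  (sval (a + c) <= sval (b + c)) = (sval a <= sval b).
Proof. exact: lm_lerD2r. Qed.

Lemma cle_eq (a a' b b' : cone S) : a = a' -> b = b' ->
  (sval a <= sval b) = (sval a' <= sval b').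
Proof. by move=> -> ->. Qed.

Lemma env_leE a b c d :
  env_le (ccl a b) (ccl c d) = (sval (a + d) <= sval (b + c)).
Proof.
rewrite /env_le; have := env_rep_ccl a b; case: (env_rep _) => a' b' h.
have := env_rep_ccl c d; case: (env_rep _) => c' d' k; rewrite /= in h k.
rewrite -(cleD2r (b + d) (a' + d')) -(cleD2r (b' + d') (a + d)).
have -> : a' + d' + (b + d) = (a' + b) + (d' + d) by ring.
have -> : b' + c' + (b + d) = (c' + d) + (b' + b) by ring.
rewrite h k; have -> : b' + a + (d' + d) = a + d + (b' + d') by ring.
by apply: cle_eq; ring.
Qed.

Fact env_addA : associative env_add.
Proof.
elim/env_ind=> a b; elim/env_ind=> c d; elim/env_ind=> e f.
by rewrite !env_addE !addrA.
Qed.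

Fact env_addC : commutative env_add.
Proof.
elim/env_ind=> a b; elim/env_ind=> c d.
by rewrite !env_addE addrC [b + d]addrC.
Qed.

Fact env_add0 : left_id env0 env_add.
Proof. by elim/env_ind=> a b; rewrite env_addE !add0r. Qed.

Fact env_addN : left_inverse env0 env_opp env_add.
Proof.
elim/env_ind=> a b; rewrite env_oppE env_addE; apply/cclP.
by rewrite !addr0 addrC.
Qed.

HB.instance Definition _ :=
  GRing.isZmodule.Build env env_addA env_addC env_add0 env_addN.

Lemma ccl_add a b c d : ccl a b + ccl c d = ccl (a + c) (b + d).
Proof. exact: env_addE. Qed.

Fact env_mulA : associative env_mul.
Proof.
elim/env_ind=> a b; elim/env_ind=> c d; elim/env_ind=> e f.
by rewrite !env_mulE; congr ccl; ring.
Qed.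

Fact env_mulC : commutative env_mul.
Proof.
elim/env_ind=> a b; elim/env_ind=> c d.
by rewrite !env_mulE; congr ccl; ring.
Qed.

Fact env_mul1 : left_id env1 env_mul.
Proof. by elim/env_ind=> a b; rewrite env_mulE; congr ccl; ring. Qed.

Fact env_mulDl : left_distributive env_mul +%R.
Proof.
elim/env_ind=> a b; elim/env_ind=> c d; elim/env_ind=> e f.
by rewrite !env_mulE !ccl_add env_mulE; congr ccl; ring.
Qed.

HB.instance Definition _ :=
  GRing.Zmodule_isComPzRing.Build env env_mulA env_mulC env_mul1 env_mulDl.

Let emb (r : R) : env :=
  ccl (cone_rho S (Num.max r 0)) (cone_rho S (Num.max (- r) 0)).

Let env_scaleE r x : env_scale r x = emb r * x.
Proof.
elim/env_ind: x => a b; rewrite [RHS]env_mulE /env_scale.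
have := env_rep_ccl a b; case: (env_rep _) => a' b' /= h.
case: leP => r0.
  have -> : Num.max (- r) 0 = 0 by apply/max_idPr; rewrite oppr_le0.
  by rewrite cone_rho0; apply/cclP; rewrite !mul0r !addr0 -!mulrDr h.
have -> : Num.max (- r) 0 = - r by apply/max_idPl; rewrite oppr_ge0 ltW.
by rewrite cone_rho0; apply/cclP; rewrite !mul0r !add0r -!mulrDr h.
Qed.

Let embP (s t : R) : 0 <= s -> 0 <= t ->
  emb (s - t) = ccl (cone_rho S s) (cone_rho S t).
Proof.
move=> s0 t0; apply/cclP.
have le0 (u : R) : 0 <= Num.max u 0 by rewrite le_max lexx orbT.
rewrite -!cone_rhoD //; congr cone_rho.
rewrite opprB; case: (leP (s - t) 0); case: (leP (t - s) 0); lra.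
Qed.

Let embK (r : R) : emb r = emb (Num.max r 0 - Num.max (- r) 0).
Proof. by congr emb; case: (leP r 0); case: (leP (- r) 0); lra. Qed.

Let embD : {morph emb : r s / r + s}.
Proof.
move=> r s; have le0 (u : R) : 0 <= Num.max u 0 by rewrite le_max lexx orbT.
rewrite (embK r) (embK s) !embP // [RHS]env_addE -!cone_rhoD //.
by rewrite -embP ?addr_ge0 //; congr emb;
  case: (leP r 0); case: (leP (- r) 0); case: (leP s 0); case: (leP (- s) 0); lra.
Qed.

Let embM : {morph emb : r s / r * s}.
Proof.
move=> r s; have le0 (u : R) : 0 <= Num.max u 0 by rewrite le_max lexx orbT.
rewrite (embK r) (embK s) !embP // [RHS]env_mulE -!cone_rhoM //.
rewrite -!cone_rhoD ?mulr_ge0 // -embP ?addr_ge0 ?mulr_ge0 //; congr emb.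
by case: (leP r 0); case: (leP (- r) 0); case: (leP s 0); case: (leP (- s) 0);
  nra.
Qed.

Let emb1 : emb 1 = 1.
Proof.
have := @embP 1 0 ler01 (lexx 0); rewrite subr0 => ->.
by rewrite cone_rho1 cone_rho0.
Qed.

Fact env_scaleA r s x : env_scale r (env_scale s x) = env_scale (r * s) x.
Proof. by rewrite !env_scaleE embM mulrA. Qed.
Fact env_scale1 x : env_scale 1 x = x.
Proof. by rewrite env_scaleE emb1 mul1r. Qed.
Fact env_scaleDr r x y : env_scale r (x + y) = env_scale r x + env_scale r y.
Proof. by rewrite !env_scaleE mulrDr. Qed.
Fact env_scaleDl r s x : env_scale (r + s) x = env_scale r x + env_scale s x.
Proof. by rewrite !env_scaleE embD mulrDl. Qed.
Fact env_scaleAl r x y : env_scale r (x * y) = env_scale r x * y.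
Proof. by rewrite !env_scaleE mulrA. Qed.

Fact env_le_refl : reflexive env_le.
Proof. by elim/env_ind=> a b; rewrite env_leE addrC lexx. Qed.

Fact env_le_anti : antisymmetric env_le.
Proof.
elim/env_ind=> a b; elim/env_ind=> c d; rewrite !env_leE => h.
apply/cclP/val_inj/le_anti; move: h; rewrite [d + a]addrC [c + b]addrC.
by case/andP=> -> ->.
Qed.

Fact env_le_trans : transitive env_le.
Proof.
elim/env_ind=> c d; elim/env_ind=> a b; elim/env_ind=> e f; rewrite !env_leE.
move=> h k; rewrite -(cleD2r (c + d)).
have -> : a + f + (c + d) = a + d + (c + f) by ring.
have -> : b + e + (c + d) = b + c + (d + e) by ring.
apply: (@le_trans _ _ (sval (b + c + (c + f)))); first by rewrite cleD2r.
by rewrite ![b + c + _]addrC cleD2r.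
Qed.

Let cjoin (a b : cone S) : cone S :=
  exist _ (Order.join (sval a) (sval b)) (le_trans (svalP a) (leUl _ _)).
Let cmeet_subproof (a b : cone S) :
  (0 : S) <= Order.meet (sval a) (sval b).
Proof. by rewrite lexI (svalP a) (svalP b). Qed.
Let cmeet (a b : cone S) : cone S :=
  exist _ (Order.meet (sval a) (sval b)) (cmeet_subproof a b).

Fact env_lexI x y z : env_le x (env_meet y z) = env_le x y && env_le x z.
Proof.
elim/env_ind: x => e f; rewrite -{2}(env_repP y) -{2}(env_repP z) /env_meet.
case: (env_rep y) (env_rep z) => [a b] [c d] /=.
rewrite -[cl _ _]/(ccl (cmeet (a + d) (b + c)) (b + d)) !env_leE.
rewrite -[sval (f + _)]/(sval f + Order.meet (sval (a + d)) (sval (b + c))).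
rewrite [sval f + _]addrC lm_meetDl lexI; congr andb.
  rewrite -[X in _ <= X]/(sval (a + d + f)) -(cleD2r d (e + b)).
  by apply: cle_eq; ring.
rewrite -[X in _ <= X]/(sval (b + c + f)) -(cleD2r b (e + d)).
by apply: cle_eq; ring.
Qed.

Fact env_leUx x y z : env_le (env_join x y) z = env_le x z && env_le y z.
Proof.
elim/env_ind: z => e f; rewrite -{2}(env_repP x) -{2}(env_repP y) /env_join.
case: (env_rep x) (env_rep y) => [a b] [c d] /=.
rewrite -[cl _ _]/(ccl (cjoin (a + d) (b + c)) (b + d)) !env_leE.
rewrite -[sval (_ + f)]/(Order.join (sval (a + d)) (sval (b + c)) + sval f).
rewrite lm_joinDl leUx; congr andb.
  rewrite -[X in X <= _]/(sval (a + d + f)) -(cleD2r d (a + f)).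
  by apply: cle_eq; ring.
rewrite -[X in X <= _]/(sval (b + c + f)) -(cleD2r b (c + f)).
by apply: cle_eq; ring.
Qed.

HB.instance Definition _ := @isLatAlg.Build R env env_scale env_le env_meet
  env_join env_scaleA env_scale1 env_scaleDr env_scaleDl env_scaleAl
  env_le_refl env_le_anti env_le_trans env_lexI env_leUx.

End Envelope.
Section EnvelopeMaps.
Variable R : realType.
Implicit Types S T : sbal R.

Definition envelope S : latAlgType R := env S.

Definition eps S (a : S) : envelope S := cl a 0.

Definition env_prec S (x y : envelope S) : Prop :=
  exists s : S, x <= eps s <= y.

Definition env_map S T (f : S -> T) (x : envelope S) : envelope T :=
  cl (f (sval (env_rep x).1)) (f (sval (env_rep x).2)).

End EnvelopeMaps.

Section Spectrum.
Variables (R : realType) (A : latAlgType R).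
Implicit Types (a b c : A) (I J : set A).

Definition l_ideal I : Prop :=
  [/\ I 0, forall a b, I a -> I b -> I (a + b), forall a b, I b -> I (a * b)
    & forall a b, labs a <= labs b -> I b -> I a].

Definition maximal_l_ideal I : Prop :=
  [/\ l_ideal I, I <> setT
    & forall J, l_ideal J -> J <> setT -> I `<=` J -> J = I].

Definition spec := {x : set A | maximal_l_ideal x}.

(* The sets of points containing an l-ideal I form a subbase of closed sets;
   spec_closed_sets says that these are all the closed sets. *)
HB.instance Definition _ := gen_eqMixin spec.
HB.instance Definition _ := gen_choiceMixin spec.
HB.instance Definition _ := isSubBaseTopological.Build spec l_ideal
  (fun I => ~` [set x : spec | I `<=` sval x]).

Definition spec_closed_sets : Prop := forall F : set spec,
  closed F <-> exists2 I, l_ideal I & F = [set x : spec | I `<=` sval x].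

Definition ddown (prec : A -> A -> Prop) (y : spec) : set A :=
  [set a | exists c : A,
    [/\ sval y c, reflexives prec c, (0 : A) <= c & labs a <= c]].

Definition spec_le (prec : A -> A -> Prop) (x y : spec) : Prop :=
  ddown prec y `<=` sval x.

(* a + x = r + x in the quotient A / x *)
Definition residue_at a (x : spec) (r : R) : Prop := sval x (a - scal A r).

Definition phi_val a (x : spec) : R := xget 0 [set r | residue_at a x r].

End Spectrum.
Section ContinuousFunctions.
Variables (R : realType) (X : topologicalType).

Definition cfun := continuousType X R.
HB.instance Definition _ := Choice.on cfun.
Implicit Types f g h : cfun.

Definition Cfun (f : X -> R) (cf : continuous f) : cfun := mkcts cf.

Lemma cfunP f g : (f : X -> R) =1 g -> f = g.
Proof. by move=> fg; apply/continuousEP. Qed.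

Fact cfun_cst_cts (r : R) : continuous (fun _ : X => r).
Proof. by move=> x; exact: cvg_cst. Qed.
Fact cfun_opp_cts f : continuous (fun x => - f x).
Proof. by move=> x; apply: cvgN; exact: cts_fun. Qed.
Fact cfun_add_cts f g : continuous (fun x => f x + g x).
Proof. by move=> x; apply: cvgD; exact: cts_fun. Qed.
Fact cfun_mul_cts f g : continuous (fun x => f x * g x).
Proof. by move=> x; apply: cvgM; exact: cts_fun. Qed.
Fact cfun_scale_cts (r : R) f : continuous (fun x => r * f x).
Proof. by move=> x; apply: cvgM; [exact: cvg_cst|exact: cts_fun]. Qed.
Fact cfun_min_cts f g : continuous (fun x => Num.min (f x) (g x)).
Proof. by move=> x; apply: continuous_min; exact: cts_fun. Qed.
Fact cfun_max_cts f g : continuous (fun x => Num.max (f x) (g x)).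
Proof. by move=> x; apply: continuous_max; exact: cts_fun. Qed.

Definition cfun0 : cfun := Cfun (@cfun_cst_cts 0).
Definition cfun1 : cfun := Cfun (@cfun_cst_cts 1).
Definition cfun_opp f : cfun := Cfun (@cfun_opp_cts f).
Definition cfun_add f g : cfun := Cfun (@cfun_add_cts f g).
Definition cfun_mul f g : cfun := Cfun (@cfun_mul_cts f g).
Definition cfun_scale (r : R) f : cfun := Cfun (@cfun_scale_cts r f).
Definition cfun_min f g : cfun := Cfun (@cfun_min_cts f g).
Definition cfun_max f g : cfun := Cfun (@cfun_max_cts f g).
Definition cfun_le f g : bool := `[< forall x, f x <= g x >].

Fact cfun_addA : associative cfun_add.
Proof. by move=> f g h; apply: cfunP => x /=; exact: addrA. Qed.
Fact cfun_addC : commutative cfun_add.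
Proof. by move=> f g; apply: cfunP => x /=; exact: addrC. Qed.
Fact cfun_add0 : left_id cfun0 cfun_add.
Proof. by move=> f; apply: cfunP => x /=; exact: add0r. Qed.
Fact cfun_addN : left_inverse cfun0 cfun_opp cfun_add.
Proof. by move=> f; apply: cfunP => x /=; exact: addNr. Qed.

HB.instance Definition _ :=
  GRing.isZmodule.Build cfun cfun_addA cfun_addC cfun_add0 cfun_addN.

Fact cfun_mulA : associative cfun_mul.
Proof. by move=> f g h; apply: cfunP => x /=; exact: mulrA. Qed.
Fact cfun_mulC : commutative cfun_mul.
Proof. by move=> f g; apply: cfunP => x /=; exact: mulrC. Qed.
Fact cfun_mul1 : left_id cfun1 cfun_mul.
Proof. by move=> f; apply: cfunP => x /=; exact: mul1r. Qed.
Fact cfun_mulDl : left_distributive cfun_mul +%R.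
Proof. by move=> f g h; apply: cfunP => x /=; exact: mulrDl. Qed.

HB.instance Definition _ :=
  GRing.Zmodule_isComPzRing.Build cfun cfun_mulA cfun_mulC cfun_mul1 cfun_mulDl.

Fact cfun_scaleA r s f : cfun_scale r (cfun_scale s f) = cfun_scale (r * s) f.
Proof. by apply: cfunP => x /=; exact: mulrA. Qed.
Fact cfun_scale1 f : cfun_scale 1 f = f.
Proof. by apply: cfunP => x /=; exact: mul1r. Qed.
Fact cfun_scaleDr r f g : cfun_scale r (f + g) = cfun_scale r f + cfun_scale r g.
Proof. by apply: cfunP => x /=; exact: mulrDr. Qed.
Fact cfun_scaleDl r s f : cfun_scale (r + s) f = cfun_scale r f + cfun_scale s f.
Proof. by apply: cfunP => x /=; exact: mulrDl. Qed.
Fact cfun_scaleAl r f g : cfun_scale r (f * g) = cfun_scale r f * g.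
Proof. by apply: cfunP => x /=; exact: mulrA. Qed.

Fact cfun_le_refl : reflexive cfun_le.
Proof. by move=> f; apply/asboolP. Qed.
Fact cfun_le_anti : antisymmetric cfun_le.
Proof.
move=> f g /andP[/asboolP fg /asboolP gf]; apply: cfunP => x.
by apply/le_anti; rewrite fg gf.
Qed.
Fact cfun_le_trans : transitive cfun_le.
Proof.
move=> g f h /asboolP fg /asboolP gh; apply/asboolP => x.
exact: le_trans (fg x) (gh x).
Qed.
Fact cfun_lexI f g h : cfun_le f (cfun_min g h) = cfun_le f g && cfun_le f h.
Proof.
apply/asboolP/andP => [fgh|[/asboolP fg /asboolP fh] x].
  by split; apply/asboolP => x; move: (fgh x); rewrite le_min => /andP[].
by rewrite /= le_min fg fh.
Qed.
Fact cfun_leUx f g h : cfun_le (cfun_max f g) h = cfun_le f h && cfun_le g h.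
Proof.
apply/asboolP/andP => [fgh|[/asboolP fg /asboolP fh] x].
  by split; apply/asboolP => x; move: (fgh x); rewrite /= ge_max => /andP[].
by rewrite /= ge_max fg fh.
Qed.

HB.instance Definition _ := @isLatAlg.Build R cfun cfun_scale cfun_le cfun_min
  cfun_max cfun_scaleA cfun_scale1 cfun_scaleDr cfun_scaleDl cfun_scaleAl
  cfun_le_refl cfun_le_anti cfun_le_trans cfun_lexI cfun_leUx.

End ContinuousFunctions.

Section CX.
Variables (R : realType) (X : nach).

Definition CXalg : latAlgType R := cfun R X.

Definition cval (f : CXalg) (x : X) : R := (f : cfun R X) x.

Lemma CX_leP (f g : CXalg) : (f <= g) <-> forall x, cval f x <= cval g x.
Proof. by split => [/asboolP|?] //; apply/asboolP. Qed.

Lemma cval_natr (n : nat) x : cval n%:R x = n%:R.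
Proof.
elim: n => [//|n IH]; rewrite -addn1 !natrD -IH.
by [].
Qed.

Lemma cval_mulrn (f : CXalg) (n : nat) x : cval (f *+ n) x = cval f x *+ n.
Proof. by elim: n => [//|n IH]; rewrite !mulrSr -IH. Qed.

Fact CX_bounded (f : CXalg) : exists n : nat, (- n%:R : CXalg) <= f <= n%:R.
Proof.
have : bounded_set (range (cval f)).
  apply: compact_bounded; apply: continuous_compact.
    by apply: continuous_subspaceT; exact: cts_fun.
  by case: (nach_ax X).
move=> [M [_ HM]]; have [n Mn] : exists n : nat, M < n%:R.
  exists (Num.bound `|M|); apply: le_lt_trans (ler_norm M) _.
  exact: archi_boundP (normr_ge0 _).
exists n; have b x : `|cval f x| <= n%:R by apply: (HM _ Mn); exists x.
apply/andP; split; apply/CX_leP => x.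
  rewrite -[leLHS]/(- cval n%:R x) cval_natr.
  by have := b x; rewrite ler_norml => /andP[].
by rewrite cval_natr; have := b x; rewrite ler_norml => /andP[].
Qed.

Fact CX_bal_axioms : bal_axioms CXalg.
Proof.
split; last 2 first.
- exact: CX_bounded.
- move=> f g fg; apply/CX_leP => x; rewrite -[leRHS]/(0 : R).
  rewrite leNgt; apply/negP => fx0.
  have [n ngt] : exists n : nat, cval g x / cval f x < n%:R.
    exists (Num.bound `|cval g x / cval f x|).
    by apply: le_lt_trans (ler_norm _) _; exact: archi_boundP (normr_ge0 _).
  move: ngt; rewrite ltr_pdivrMr // mulrC mulr_natr -cval_mulrn ltNge.
  by move: (fg n) => /CX_leP -> .
- move=> f g h /CX_leP fg; apply/CX_leP => x; exact: (lerD (fg x) (lexx _)).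
- move=> f g /CX_leP f0 /CX_leP g0; apply/CX_leP => x.
  exact: (mulr_ge0 (f0 x) (g0 x)).
- move=> r f r0 /CX_leP f0; apply/CX_leP => x; exact: (mulr_ge0 r0 (f0 x)).
Qed.

Definition CX : bal R := Bal CX_bal_axioms.

Definition order_preserving (f : CXalg) : Prop :=
  forall x y, nach_le x y -> cval f x <= cval f y.

Definition CX_prec (f g : CX) : Prop :=
  exists c : CX, [/\ order_preserving c, f <= c & c <= g].

End CX.
Section CleX.
Variables (R : realType) (X : nach).

Definition cle := {f : CX R X | order_preserving f}.
HB.instance Definition _ := gen_eqMixin cle.
HB.instance Definition _ := gen_choiceMixin cle.

Definition cle_val (f : cle) (x : X) : R := cval (sval f) x.
Implicit Types f g h : cle.

Lemma cleP f g : cle_val f =1 cle_val g -> f = g.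
Proof.
case: f g => [f hf] [g hg] fg; have e : f = g by exact: cfunP.
by subst g; congr exist; exact: Prop_irrelevance.
Qed.

Lemma cle_homo f x y : nach_le x y -> cle_val f x <= cle_val f y.
Proof. exact: (svalP f). Qed.

Fact cle_cst_subproof (r : R) :
  order_preserving (Cfun (@cfun_cst_cts R X r) : CX R X).
Proof. by move=> x y _; exact: lexx. Qed.
Definition cle_cst (r : R) : cle := exist _ _ (cle_cst_subproof r).

Fact cle_add_subproof f g : order_preserving (sval f + sval g).
Proof. by move=> x y xy; exact: (lerD (cle_homo f xy) (cle_homo g xy)). Qed.
Definition cle_add f g : cle := exist _ _ (cle_add_subproof f g).

Fact cle_min_subproof f g : order_preserving (Order.meet (sval f) (sval g)).
Proof.
move=> x y xy; rewrite -[leLHS]/(Num.min (cle_val f x) (cle_val g x)).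
rewrite -[leRHS]/(Num.min (cle_val f y) (cle_val g y)).
exact: le_min2 (cle_homo f xy) (cle_homo g xy).
Qed.
Definition cle_min f g : cle := exist _ _ (cle_min_subproof f g).

Fact cle_max_subproof f g : order_preserving (Order.join (sval f) (sval g)).
Proof.
move=> x y xy; rewrite -[leLHS]/(Num.max (cle_val f x) (cle_val g x)).
rewrite -[leRHS]/(Num.max (cle_val f y) (cle_val g y)).
exact: le_max2 (cle_homo f xy) (cle_homo g xy).
Qed.
Definition cle_max f g : cle := exist _ _ (cle_max_subproof f g).

Definition cle_le f g : bool := sval f <= sval g.

Fact cle_addA : associative cle_add.
Proof. by move=> f g h; apply: cleP => x; exact: addrA. Qed.
Fact cle_addC : commutative cle_add.
Proof. by move=> f g; apply: cleP => x; exact: addrC. Qed.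
Fact cle_add0 : left_id (cle_cst 0) cle_add.
Proof. by move=> f; apply: cleP => x; exact: add0r. Qed.

HB.instance Definition _ :=
  GRing.isNmodule.Build cle cle_addA cle_addC cle_add0.

Fact cle_le_refl : reflexive cle_le.
Proof. by move=> f; exact: lexx. Qed.
Fact cle_le_anti : antisymmetric cle_le.
Proof. by move=> f g /le_anti fg; apply: cleP => x; rewrite /cle_val fg. Qed.
Fact cle_le_trans : transitive cle_le.
Proof. by move=> f g h; exact: le_trans. Qed.
Fact cle_lexI f g h : cle_le f (cle_min g h) = cle_le f g && cle_le f h.
Proof. exact: lexI. Qed.
Fact cle_leUx f g h : cle_le (cle_max f g) h = cle_le f h && cle_le g h.
Proof. exact: leUx. Qed.
Fact cle_leD2r f g h : cle_le f g = cle_le (f + h) (g + h).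
Proof.
by apply/idP/idP => /CX_leP fg; apply/CX_leP => x; move: (fg x);
  rewrite -[cval (sval (f + h)) x]/(cle_val f x + cle_val h x)
    -[cval (sval (g + h)) x]/(cle_val g x + cle_val h x) lerD2r.
Qed.
Fact cle_joinDl f g h : cle_max f g + h = cle_max (f + h) (g + h).
Proof. by apply: cleP => x; exact: addr_maxl. Qed.
Fact cle_meetDl f g h : cle_min f g + h = cle_min (f + h) (g + h).
Proof. by apply: cleP => x; exact: addr_minl. Qed.

HB.instance Definition _ := @isLMonoid.Build cle cle_le cle_min cle_max
  cle_le_refl cle_le_anti cle_le_trans cle_lexI cle_leUx cle_leD2r
  cle_joinDl cle_meetDl.

Definition cle_lm : lMonoidType := cle.

Lemma cle_leP (f g : cle_lm) : f <= g <-> forall x, cle_val f x <= cle_val g x.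
Proof. exact: CX_leP. Qed.

Implicit Types u v w : cone cle_lm.

Fact cle_ge0 u x : 0 <= cle_val (sval u) x.
Proof. by have /cle_leP := svalP u; exact. Qed.

Fact cle_mul_subproof u v : order_preserving (sval (sval u) * sval (sval v)).
Proof.
move=> x y xy; exact: (ler_pM (cle_ge0 u x) (cle_ge0 v x)
  (cle_homo (sval u) xy) (cle_homo (sval v) xy)).
Qed.
Definition cle_mul u v : cle_lm := exist _ _ (cle_mul_subproof u v).

Fact cle_mul_ge0 u v : (0 : cle_lm) <= cle_mul u v.
Proof. by apply/cle_leP => x; exact: (mulr_ge0 (cle_ge0 u x) (cle_ge0 v x)). Qed.
Definition cle_cone_mul u v : cone cle_lm :=
  exist _ (cle_mul u v) (cle_mul_ge0 u v).

Fact cle_one_ge0 : (0 : cle_lm) <= cle_cst 1.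
Proof. by apply/cle_leP => x; exact: ler01. Qed.
Definition cle_one : cone cle_lm := exist _ (cle_cst 1 : cle_lm) cle_one_ge0.

Lemma cle_coneP u v : cle_val (sval u) =1 cle_val (sval v) -> u = v.
Proof. by move=> uv; apply: val_inj; exact: cleP. Qed.

Definition Cle_lsemialg : lsemialg R.
Proof.
apply: (@LSemialg R cle_lm cle_cone_mul cle_one cle_cst) => //.
- by move=> u v; apply: cle_coneP => x; exact: mulrC.
- by move=> u v w; apply: cle_coneP => x; exact: mulrA.
- by move=> u; apply: cle_coneP => x; exact: mul1r.
- by move=> u v w; apply: cle_coneP => x; exact: mulrDr.
- move=> u v w /cle_leP uv; apply/cle_leP => x.
  exact: (ler_wpM2r (cle_ge0 w x) (uv x)).
- by move=> r s; apply: cleP => x.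
- by move=> r s; rewrite meetEtotal; apply: cleP => x.
- by move=> r s; rewrite joinEtotal; apply: cleP => x.
- move=> r s u v _ _ ur vs; apply: cleP => x.
  by rewrite -[LHS]/(cle_val (sval u) x * cle_val (sval v) x) ur vs.
Defined.

Fact Cle_bounded (f : Cle_lsemialg) :
  exists2 r : R, 0 <= r & (rho (- r) <= f <= rho r).
Proof.
have [n /andP[h1 h2]] := CX_bounded (sval f); exists n%:R; first exact: ler0n.
apply/andP; split; apply/cle_leP => x.
  move/CX_leP : h1 => /(_ x); rewrite -[leLHS]/(- cval n%:R x) cval_natr; exact.
by move/CX_leP : h2 => /(_ x); rewrite cval_natr; exact.
Qed.

Lemma cle_val_mulrn (f : Cle_lsemialg) (n : nat) x :
  cle_val (f *+ n) x = cle_val f x *+ n.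
Proof. by elim: n => [//|n IH]; rewrite !mulrSr -IH. Qed.

Fact Cle_archimedean (a b c d : Cle_lsemialg) :
  (forall n : nat, a *+ n + b <= c *+ n + d) -> a <= c.
Proof.
move=> h; apply/cle_leP => x; rewrite leNgt; apply/negP => ac.
have {}h (n : nat) : cle_val a x *+ n + cle_val b x <=
    cle_val c x *+ n + cle_val d x.
  move: (h n) => /cle_leP /(_ x).
  by rewrite -[leLHS]/(cle_val (a *+ n) x + _) -[leRHS]/(cle_val (c *+ n) x + _)
    !cle_val_mulrn.
set e := cle_val a x - cle_val c x; have e0 : 0 < e by rewrite subr_gt0.
pose n := Num.bound `|(cle_val d x - cle_val b x) / e|.
have : (cle_val d x - cle_val b x) / e < n%:R.
  apply: le_lt_trans (ler_norm _) _; exact: archi_boundP (normr_ge0 _).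
rewrite ltr_pdivrMr // ltNge => /negP; apply.
by move: (h n); rewrite -(mulr_natl (cle_val a x)) -(mulr_natl (cle_val c x))
  mulrBr lerBlDr addrAC lerBrDr [leRHS]addrC.
Qed.

Definition Cle : sbal R := Sbal Cle_bounded Cle_archimedean.

End CleX.
(* The inclusion of the envelope of C_<=(X) into C(X): [f, g] |-> f - g. *)
Definition env_incl (R : realType) (X : nach) (x : envelope (Cle R X)) : CX R X :=
  sval (sval (env_rep x).1) - sval (sval (env_rep x).2).

(* Main.v *)
(* A maximal l-ideal x has quotient R even for an envelope that is not an f-ring:
   an order ideal generated by a positive reflexive element k is a ring ideal,
   because multiplication by k is a positive operator; hence modulo x such a k
   either vanishes or is bounded below by a positive real.  Thus points of the
   spectrum are the same thing as characters A -> R, their order is the pointwise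
   order on reflexive elements, and compactness follows by taking limits of
   characters along an ultrafilter.  Conversely, for a Nachbin space X, Nachbin's
   order version of Urysohn's lemma separates points by C_<=(X), so that
   C_<=(X) - C_<=(X) is dense in C(X) by the lattice form of the Stone-Weierstrass
   theorem, and evaluation embeds X into the spectrum.  The embedding is onto: its
   image is closed, and a point off the image would be separated from it by an
   element vanishing at every point of X.  The adjunction identities are then
   checked by evaluating characters. *)
Require Import Defs.
From HB Require Import structures.
From mathcomp Require Import all_boot all_order all_algebra.
From mathcomp Require Import ring lra finmap.
From mathcomp Require Import all_classical all_reals topology normedtype.

Set Implicit Arguments.
Unset Strict Implicit.
Unset Printing Implicit Defensive.

Import Order.TTheory GRing.Theory Num.Theory.
Import numFieldNormedType.Exports.
Local Open Scope classical_set_scope.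
Local Open Scope ring_scope.

(** * Separation in Nachbin spaces *)

(** Both adjunctions run through one structure, [ordered_by K], where [K] consists of the reflexive
    elements of an object of nbal or of the values of [eps] in an envelope, so that spectra and
    evaluation maps are treated once. The obstacle that shapes it is the possible failure of |ab| <=
    |a||b| in an envelope. What survives is that every element is a difference of two multipliers,
    elements whose multiplication preserves positivity. Modulo an l-ideal this still bounds |ab| by
    a constant depending on a times any multiplier dominating |b| ([leM_mul_labs]), which is what
    makes the order ideal of a positive element of [K], and the set of infinitesimals, closed under
    multiplication. Real residues are then Dedekind cuts, found first on [K] and carried to all
    elements by density. Characters are preferred to ideals because limits and composites of
    characters are again characters, and the kernel of a character is automatically maximal. *)

(** Compactness as an induction on sets. If [Q setT] failed, the sets whose complement satisfies [Q]
    would form a proper filter, and a cluster point of it would contradict the local hypothesis. *)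
Lemma compact_set_ind (T : topologicalType) (Q : set T -> Prop) :
  compact [set: T] -> Q set0 ->
  (forall A B, A `<=` B -> Q B -> Q A) ->
  (forall A B, Q A -> Q B -> Q (A `|` B)) ->
  (forall x : T, exists2 B : set T, nbhs x B & Q B) -> Q setT.
Proof.
move=> cT Q0 Qsub QU Qloc; apply: contrapT => nQ.
pose F : set_system T := [set A | Q (~` A)].
have FF : ProperFilter F.
  apply: Build_ProperFilter_ex => [A QA|].
    apply: contrapT => /forallNP A0; apply: nQ; apply: Qsub QA => x _ Ax.
    exact: A0 Ax.
  split.
  - by rewrite /F /= setCT.
  - by move=> A B QA QB; rewrite /F /= setCI; exact: QU.
  - by move=> A B AB; apply: Qsub; exact: subsetC.
have [|p [_ clp]] := cT F FF; first by rewrite /F /= setCT.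
have [B pB QB] := Qloc p.
have FB : F (~` B) by rewrite /F /= setCK.
by have [x []] := clp _ _ FB pB.
Qed.

Section NachbinSeparation.
Variable X : nach.
Implicit Types (x y : X) (A D E K U V : set X).

Definition downset A := forall x y, nach_le x y -> A y -> A x.

Let cX : compact [set: X]. Proof. by case: (nach_ax X). Qed.
Let lexx' x : nach_le x x. Proof. by case: (nach_ax X). Qed.
Let letrans x y z : nach_le x y -> nach_le y z -> nach_le x z.
Proof. by case: (nach_ax X) => _ _ _ + _; apply. Qed.
Let graph_closed : closed [set p : X * X | nach_le p.1 p.2].
Proof. by case: (nach_ax X). Qed.

(** If all neighbourhoods of u and v meet, every box around (u, v) contains a pair (z, z), so
    closedness of the order forces u <= v. The situation is symmetric and the order
    antisymmetric. *)
Lemma nach_hausdorff : hausdorff_space X.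
Proof.
move=> p q clpq; case: (nach_ax X) => _ _ anti _ _.
have key (u v : X) : cluster (nbhs u) v -> nach_le u v.
  move=> cluv; apply: contrapT => nuv.
  have [[A B] /= [uA vB] AB] : nbhs (u, v) (~` [set p : X * X | nach_le p.1 p.2]).
    by apply: open_nbhs_nbhs; split; [exact: closed_openC|].
  have [z [Az Bz]] := cluv _ _ uA vB.
  exact: (AB (z, z) (conj Az Bz) (lexx' z)).
apply: anti; apply: key => // A B qA pB.
by have [z [Az Bz]] := clpq _ _ pB qA; exists z.
Qed.

Lemma nach_normal : normal_space X.
Proof. exact: compact_normal nach_hausdorff cX. Qed.

(** A projection of a compact set, namely the part of the graph of the order over [K]. *)
Lemma downclosure_closed K :
  closed K -> closed [set x : X | exists2 y, K y & nach_le x y].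
Proof.
move=> cK; apply: compact_closed nach_hausdorff _.
pose G := [set p : X * X | nach_le p.1 p.2] `&` (snd @^-1` K).
have -> : [set x : X | exists2 y, K y & nach_le x y] = fst @` G.
  apply/seteqP; split => [x [y Ky xy]|x [[u v] [/= uv Kv] <-]].
    by exists (x, y).
  by exists v.
apply: continuous_compact.
  by apply: continuous_subspaceT => x; exact: cvg_fst.
apply: (@subclosed_compact _ _ ([set: X] `*` [set: X])) => //.
  apply: closedI graph_closed _.
  by apply: preimage_closed cK => x _; exact: cvg_snd.
exact: compact_setX.
Qed.

Lemma upclosure_closed K :
  closed K -> closed [set x : X | exists2 y, K y & nach_le y x].
Proof.
move=> cK; apply: compact_closed nach_hausdorff _.
pose G := [set p : X * X | nach_le p.1 p.2] `&` (fst @^-1` K).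
have -> : [set x : X | exists2 y, K y & nach_le y x] = snd @` G.
  apply/seteqP; split => [x [y Ky xy]|x [[u v] [/= uv Kv] <-]].
    by exists (y, x).
  by exists u.
apply: continuous_compact.
  by apply: continuous_subspaceT => x; exact: cvg_snd.
apply: (@subclosed_compact _ _ ([set: X] `*` [set: X])) => //.
  apply: closedI graph_closed _.
  by apply: preimage_closed cK => x _; exact: cvg_fst.
exact: compact_setX.
Qed.

(* An open and a closed downset, thought of as a set and its closure. *)
Definition down_pair (p : set X * set X) :=
  [/\ open p.1, downset p.1, closed p.2, downset p.2 & p.1 `<=` p.2].

(** Normality yields sets between [D] and [U] that need not be downsets. The open one is shrunk to
    the largest downset inside it, [V], and the closed one enlarged to its down-closure [E]; these
    stay open and closed because up- and down-closures of closed sets are closed. *)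
Lemma down_pair_interp (p q : set X * set X) : down_pair p -> down_pair q ->
  p.2 `<=` q.1 ->
  exists m, [/\ down_pair m, p.2 `<=` m.1 & m.2 `<=` q.1].
Proof.
case: p q => [W D] [U F] [/= _ _ cD dD _] [/= oU dU _ _ _] DU.
have DnU : set_nbhs D U by apply/set_nbhsP; exists U; split; last exact: subset_refl.
have [B DB BU] := nach_normal cD DnU.
have [O [oO DO OB]] := (set_nbhsP _ _).1 DB.
pose V := ~` [set x : X | exists2 y, (~` O) y & nach_le y x].
pose E := [set x : X | exists2 y, closure B y & nach_le x y].
have VO : V `<=` O.
  by move=> x Vx; apply: contrapT => nOx; apply: Vx; exists x.
exists (V, E); split => /=.
- split => /=.
  + by apply/closed_openC/upclosure_closed/open_closedC.
  + by move=> x y xy Vy [z Oz zx]; apply: Vy; exists z => //; exact: letrans xy.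
  + exact/downclosure_closed/closed_closure.
  + by move=> x y xy [z Bz yz]; exists z => //; exact: letrans yz.
  + by move=> x /VO/OB/subset_closure Bx; exists x.
- by move=> x Dx [z Oz zx]; apply/Oz/DO; exact: dD Dx.
- by move=> x [z /BU Uz xz]; exact: dU Uz.
Qed.

Section Dyadic.
Variables (R : realType) (D U : set X).
Hypotheses (cD : closed D) (dD : downset D) (oU : open U) (dU : downset U).
Hypothesis DU : D `<=` U.

Let mid (p q : set X * set X) : set X * set X :=
  xget p [set m | [/\ down_pair m, p.2 `<=` m.1 & m.2 `<=` q.1]].

(* The n-th level at k sits at the dyadic number k / 2 ^ n. *)
Fixpoint dyadic_pair (n k : nat) : set X * set X :=
  match n with
  | 0 => match k with 0 => (set0, D) | 1 => (U, setT) | _ => (setT, setT) end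
  | n.+1 => if odd k then mid (dyadic_pair n k./2) (dyadic_pair n k./2.+1)
            else dyadic_pair n k./2
  end.
Local Notation g := dyadic_pair.

(** The two claims need a common induction: the nesting of neighbours at one level is what [mid]
    needs at the next, where an odd index k lies between the previous indices k./2 and k./2.+1. *)
Let gP n k : down_pair (g n k) /\ (g n k).2 `<=` (g n k.+1).1.
Proof.
have sT : downset setT by [].
elim: n k => [|n IH] k.
  case: k => [|[|k]] /=; split => //; split => //=;
    by [exact: open0 | exact: openT | exact: closedT].
have midP j := xgetPex (g n j)
  (down_pair_interp (IH j).1 (IH j.+1).1 (IH j).2).
rewrite /= uphalf_half; case: (boolP (odd k)) => ok /=.
  by have [m1 m2 m3] := midP k./2; rewrite add1n.
by have [m1 m2 m3] := midP k./2; rewrite add0n; split => //; case: (IH k./2).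
Qed.

Let g_lt n k l : (k < l)%N -> (g n k).2 `<=` (g n l).1.
Proof.
elim: l => // l IH; rewrite ltnS leq_eqVlt => /orP[/eqP->|kl].
  by case: (gP n l).
apply: subset_trans (IH kl) _; case: (gP n l) => -[_ _ _ _ h] h'.
exact: subset_trans h h'.
Qed.

Let g_refine m n k : g (m + n) (k * 2 ^ m) = g n k.
Proof.
elim: m => [|m IH]; first by rewrite muln1.
by rewrite addSn expnS mulnCA mul2n /= odd_double doubleK.
Qed.

Let dy n k : R := k%:R / 2 ^+ n.

Let g_dy n k m l : dy n k < dy m l -> (g n k).2 `<=` (g m l).1.
Proof.
rewrite /dy ltr_pdivrMr ?exprn_gt0 // mulrAC ltr_pdivlMr ?exprn_gt0 //.
rewrite -!natrX -!natrM ltr_nat => kl.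
by rewrite -(g_refine m n k) -(g_refine n m l) [(n + m)%N]addnC; exact: g_lt.
Qed.

Let dyadic_dense (s t : R) : 0 <= s -> s < t -> exists n k, s < dy n k < t.
Proof.
move=> s0 st; have ts0 : 0 < t - s by rewrite subr_gt0.
pose n := Num.bound (t - s)^-1.
have hn : (t - s)^-1 < 2 ^+ n.
  apply: lt_trans (archi_boundP _) _; first by rewrite invr_ge0 ltW.
  by rewrite -natrX ltr_nat ltn_expl.
have n0 : 0 < 2 ^+ n :> R by rewrite exprn_gt0.
have /andP[h1 h2] := Num.Theory.truncn_itv (mulr_ge0 s0 (ltW n0)).
exists n, (Num.truncn (s * 2 ^+ n)).+1; rewrite /dy.
rewrite ltr_pdivlMr // h2 ltr_pdivrMr //= -natr1.
apply: (le_lt_trans (lerD h1 (lexx 1))); rewrite -ltrBrDl -mulrBl.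
by rewrite -[ltLHS](mulfV (lt0r_neq0 ts0)) ltr_pM2l.
Qed.

Let vals x := [set r : R | exists n k, r = dy n k /\ (g n k).1 x].
(** Urysohn's function. It is monotone because the open sets of the pairs are downsets, so a smaller
    point belongs to more of them. *)
Let f x : R := inf (vals x).

Let dy_ge0 n k : 0 <= dy n k.
Proof. by rewrite divr_ge0 ?exprn_ge0 ?ler0n. Qed.

Let vals_lb x : has_lbound (vals x).
Proof. by exists 0 => _ [n [k [-> _]]]. Qed.

Let vals_n0 x : vals x !=set0.
(* At level 0 the pair of index 2 is the whole space, so the infimum is never over the empty set. *)
Proof. by exists (dy 0 2), 0%N, 2%N. Qed.

Let f_ge0 x : 0 <= f x.
Proof. by apply: lb_le_inf (vals_n0 x) _ => _ [n [k [-> _]]]. Qed.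

Let f_le n k x : (g n k).1 x -> f x <= dy n k.
Proof. by move=> h; apply: (ge_inf (vals_lb x)); exists n, k. Qed.

Let f_lt x t : f x < t -> exists n k, dy n k < t /\ (g n k).1 x.
Proof.
by move=> /(inf_lt (vals_n0 x))[_ [n [k [-> h]]] lt]; exists n, k.
Qed.

Let f_homo x y : nach_le x y -> f x <= f y.
Proof.
move=> xy; apply: lb_le_inf (vals_n0 y) _ => _ [n [k [-> h]]]; apply: f_le.
by case: (gP n k) => -[_ d _ _ _] _; exact: d h.
Qed.

Let f_D x : D x -> f x = 0.
Proof.
move=> Dx; apply/le_anti; rewrite f_ge0 andbT leNgt; apply/negP => fx.
have [n [k /andP[k0 kf]]] := dyadic_dense (lexx 0) fx.
have : dy 0 0 < dy n k by rewrite {1}/dy mul0r.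
by move=> /g_dy/(_ x Dx)/f_le; rewrite leNgt kf.
Qed.

Let f_U x : ~ U x -> 1 <= f x.
Proof.
move=> nU; apply: lb_le_inf (vals_n0 x) _ => _ [n [k [-> h]]].
rewrite leNgt; apply/negP => lt1; apply: nU.
have : dy n k < dy 0 1 by rewrite {2}/dy expr0 divr1.
by move=> /g_dy; apply; case: (gP n k) => -[_ _ _ _ +] _; apply.
Qed.

Let f_continuous : continuous (f : X -> R).
Proof.
move=> x; apply/cvgrPdist_lt => e e0.
have near1 : \forall y \near x, f y < f x + e.
  have [n [k [lt gx]]] : exists n k, dy n k < f x + e /\ (g n k).1 x.
    by apply: f_lt; rewrite ltrDl.
  case: (gP n k) => -[o _ _ _ _] _.
  have := @open_nbhs_nbhs _ x _ (conj o gx); apply: filterS => y gy.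
  exact: le_lt_trans (f_le gy) lt.
have near2 : \forall y \near x, f x - e < f y.
  have [fx|fx] := ltP (f x - e) 0; first by near=> y; exact: lt_le_trans fx _.
  (* Two dyadics below [f x] are needed: missing the open set at the larger one puts x outside the
     closed set at the smaller one, whose complement is the required neighbourhood. *)
  have [n [k /andP[nk1 nk2]]] : exists n k, f x - e < dy n k < f x.
    by apply: dyadic_dense => //; rewrite gtrBl.
  have [m [l /andP[ml1 ml2]]] := dyadic_dense fx nk1.
  have gx : ~ (g m l).2 x.
    by move=> /(g_dy ml2)/f_le; rewrite leNgt nk2.
  case: (gP m l) => -[_ _ c _ _] _.
  have := @open_nbhs_nbhs _ x _ (conj (closed_openC c) gx).
  apply: filterS => y gy; apply: lt_le_trans ml1 _.
  apply: lb_le_inf (vals_n0 y) _ => _ [i [j [-> h]]].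
  rewrite leNgt; apply/negP => lt; apply: gy.
  case: (gP m l) => -[_ _ _ _ +] _; apply; apply: (g_dy lt).
  by case: (gP i j) => -[_ _ _ _ +] _; apply.
near=> y; rewrite ltr_distlC; apply/andP; split; near: y.
  exact: near2.
exact: near1.
Unshelve. all: by end_near. Qed.

Lemma order_urysohn : exists f : CX R X, [/\ order_preserving f,
  forall x, D x -> cval f x = 0 & forall x, ~ U x -> 1 <= cval f x].
Proof. by exists (Cfun f_continuous). Qed.

End Dyadic.

Lemma order_separation (R : realType) x y : ~ nach_le x y ->
  exists2 f : CX R X, order_preserving f & cval f y < cval f x.
Proof.
move=> nxy; have c1 (z : X) : closed [set z].
  exact/accessible_closed_set1/hausdorff_accessible/nach_hausdorff.
(* [D] is the principal downset of y and [U] the complement of the principal upset of x; [D] lies in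
   [U] because x <= y fails. *)
pose D := [set z : X | exists2 w, [set y] w & nach_le z w].
pose U := ~` [set z : X | exists2 w, [set x] w & nach_le w z].
have [|||||f [fh fD fU]] := @order_urysohn R D U.
- exact: downclosure_closed.
- by move=> u v uv [_ -> vy]; exists y => //; exact: letrans vy.
- exact/closed_openC/upclosure_closed.
- by move=> u v uv Uv [w wx wu]; apply: Uv; exists w => //; exact: letrans uv.
- by move=> u [_ -> uy] [_ -> xu]; apply: nxy; exact: letrans uy.
exists f => //; apply: lt_le_trans (fU x _); last by apply; exists x.
by rewrite fD ?ltr01 //; exists y.
Qed.

End NachbinSeparation.

(** * Density of differences of order preserving functions *)

Section KakutaniStone.
Variables (R : realType) (X : nach).
Implicit Types (f g h u v : CX R X).

Lemma cvalB f g x : cval (f - g) x = cval f x - cval g x. Proof. by []. Qed.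
Lemma cvalD f g x : cval (f + g) x = cval f x + cval g x. Proof. by []. Qed.
Lemma cvalM f g x : cval (f * g) x = cval f x * cval g x. Proof. by []. Qed.
Lemma cvalZ r f x : cval (r *: f) x = r * cval f x. Proof. by []. Qed.
Lemma cvalU f g x : cval (Order.join f g) x = Num.max (cval f x) (cval g x).
Proof. by []. Qed.
Lemma cvalI f g x : cval (Order.meet f g) x = Num.min (cval f x) (cval g x).
Proof. by []. Qed.
Lemma cval_scal (r : R) x : cval (scal (CX R X) r) x = r.
Proof. exact: mulr1. Qed.

Lemma CX_ext f g : cval f =1 cval g -> f = g.
Proof. by move=> fg; exact: cfunP. Qed.

Lemma near_lt_cval f g x : cval f x < cval g x ->
  \forall y \near x, cval f y < cval g y.
Proof.
move=> fg; have /(_ x) := @cts_fun _ _ (g - f : cfun R X).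
move=> /cvgrPdist_lt/(_ _ (etrans (subr_gt0 _ _) fg)).
apply: filterS => y; rewrite -[X in `|X - _|]/(cval g x - cval f x).
rewrite -[X in `|_ - X|]/(cval g y - cval f y) ltr_distlC => /andP[+ _].
by rewrite subrr subr_gt0.
Qed.

Lemma order_preserving_scal (r : R) : order_preserving (scal (CX R X) r).
Proof. by move=> x y _; rewrite !cval_scal. Qed.

Lemma order_preservingD f g : order_preserving f -> order_preserving g ->
  order_preserving (f + g).
Proof. by move=> hf hg x y xy; rewrite !cvalD lerD ?hf ?hg. Qed.

Lemma order_preservingU f g : order_preserving f -> order_preserving g ->
  order_preserving (Order.join f g).
Proof. by move=> hf hg x y xy; rewrite !cvalU le_max2 ?hf ?hg. Qed.

Lemma order_preservingI f g : order_preserving f -> order_preserving g ->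
  order_preserving (Order.meet f g).
Proof. by move=> hf hg x y xy; rewrite !cvalI le_min2 ?hf ?hg. Qed.

Lemma order_preservingZ (r : R) f : 0 <= r -> order_preserving f ->
  order_preserving (r *: f).
Proof. by move=> r0 hf x y xy; rewrite !cvalZ ler_wpM2l ?hf. Qed.

Definition order_diff u := exists f g : CX R X,
  [/\ order_preserving f, order_preserving g & u = f - g].

Lemma order_diff_incl f : order_preserving f -> order_diff f.
Proof.
move=> hf; exists f, (scal _ 0); split => //.
by apply: CX_ext => x; rewrite cvalB cval_scal subr0.
Qed.

Lemma order_diffD u v : order_diff u -> order_diff v -> order_diff (u + v).
Proof.
move=> [f [g [hf hg ->]]] [f' [g' [hf' hg' ->]]].
by exists (f + f'), (g + g'); split; [exact: order_preservingD..|];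
  rewrite opprD addrACA.
Qed.

Lemma order_diffZ (r : R) u : order_diff u -> order_diff (r *: u).
Proof.
move=> [f [g [hf hg ->]]]; have [r0|r0] := leP 0 r.
  by exists (r *: f), (r *: g); split; [exact: order_preservingZ..|];
    rewrite scalerBr.
have nr0 : 0 <= - r by rewrite oppr_ge0 ltW.
exists (- r *: g), (- r *: f); split; [exact: order_preservingZ..|].
by rewrite -scalerBr -[f - g]opprB scalerN scaleNr.
Qed.

(** Adding g + g' to both differences turns their join into a join of order preserving functions. *)
Lemma order_diffU u v :
  order_diff u -> order_diff v -> order_diff (Order.join u v).
Proof.
move=> [f [g [hf hg ->]]] [f' [g' [hf' hg' ->]]].
exists (Order.join (f + g') (f' + g)), (g + g'); split.
- by apply: order_preservingU; exact: order_preservingD.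
- exact: order_preservingD.
apply: CX_ext => x; rewrite cvalB !cvalU !cvalB !cvalD.
by rewrite [RHS]addr_maxl; congr Num.max; ring.
Qed.

Lemma order_diffI u v :
  order_diff u -> order_diff v -> order_diff (Order.meet u v).
Proof.
move=> [f [g [hf hg ->]]] [f' [g' [hf' hg' ->]]].
exists (Order.meet (f + g') (f' + g)), (g + g'); split.
- by apply: order_preservingI; exact: order_preservingD.
- exact: order_preservingD.
apply: CX_ext => x; rewrite cvalB !cvalI !cvalB !cvalD.
by rewrite [RHS]addr_minl; congr Num.min; ring.
Qed.

(** Two-point interpolation, the input of the Stone-Weierstrass argument. For distinct points
    antisymmetry makes x <= y or y <= x false, so an order preserving function separates them, and
    an affine image of it takes the two values. *)
Lemma order_diff_interp (x y : X) (a b : R) : (x = y -> a = b) ->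
  exists u, [/\ order_diff u, cval u x = a & cval u y = b].
Proof.
move=> ab; have [xy|/eqP xy] := eqVneq x y.
  exists (scal _ a); rewrite !cval_scal -(ab xy); split => //.
  exact/order_diff_incl/order_preserving_scal.
have [e he exy] : exists2 e : CX R X, order_preserving e & cval e x != cval e y.
  have [xley|/(order_separation R)[e he exy]] := pselect (nach_le x y).
    have [ylex|/(order_separation R)[e he exy]] := pselect (nach_le y x).
      by case: (nach_ax X) => _ _ anti _ _; case: xy; exact: anti.
    by exists e => //; rewrite lt_eqF.
  by exists e => //; rewrite gt_eqF.
pose c := (b - a) / (cval e y - cval e x).
exists (c *: e + scal _ (a - c * cval e x)); split.
- apply: order_diffD; last exact/order_diff_incl/order_preserving_scal.
  exact/order_diffZ/order_diff_incl.
- by rewrite cvalD cvalZ cval_scal addrC subrK.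
rewrite cvalD cvalZ cval_scal.
have -> : c * cval e y + (a - c * cval e x) = c * (cval e y - cval e x) + a.
  by ring.
by rewrite /c divfK ?subrK // subr_eq0 eq_sym.
Qed.

Let cX : compact [set: X]. Proof. by case: (nach_ax X). Qed.

(** Each interpolant agrees with [f] at [x] and stays below f + e near one further point; finite
    meets keep the value at [x] and combine the bounds. *)
Lemma order_diff_dense_above f (e : R) (x : X) : 0 < e ->
  exists u, [/\ order_diff u, cval u x = cval f x &
    forall y, cval u y < cval f y + e].
Proof.
move=> e0; pose Q (A : set X) := exists u, [/\ order_diff u, cval u x = cval f x &
    forall y, A y -> cval u y < cval f y + e].
suff [u [h1 h2 h3]] : Q setT by exists u; split => // y; exact: h3.
apply: compact_set_ind => //.
- exists (scal _ (cval f x)); split => //; last exact: cval_scal.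
  exact/order_diff_incl/order_preserving_scal.
- by move=> A B AB [u [h1 h2 h3]]; exists u; split => // y /AB; exact: h3.
- move=> A B [u [h1 h2 h3]] [v [k1 k2 k3]]; exists (Order.meet u v); split.
  + exact: order_diffI.
  + by rewrite cvalI h2 k2 minxx.
  + by move=> y [/h3|/k3] h; rewrite cvalI gt_min h ?orbT.
move=> y; have [|u [h1 h2 h3]] := @order_diff_interp x y (cval f x) (cval f y).
  by move=> ->.
exists [set z | cval u z < cval f z + e]; last by exists u.
have := @near_lt_cval u (f + scal _ e) y; rewrite cvalD cval_scal h3 ltrDl.
by move=> /(_ e0); apply: filterS => z; rewrite cvalD cval_scal.
Qed.

(** The dual pass, over the base points: finite joins of the functions from [order_diff_dense_above]
    remain below f + e and rise above f - e everywhere. *)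
Lemma order_diff_dense f (e : R) : 0 < e ->
  exists2 u, order_diff u & forall x, `|cval f x - cval u x| < e.
Proof.
move=> e0; pose Q (A : set X) := exists u, [/\ order_diff u,
    forall y, cval u y < cval f y + e & forall y, A y -> cval f y < cval u y + e].
suff [u [h1 h2 h3]] : Q setT.
  exists u => // x; rewrite ltr_distlC; apply/andP; split => //.
  by rewrite ltrBlDr; exact: h3.
apply: compact_set_ind => //.
(* Any base point supplies a function below f + e; if there are no points, a constant will do. *)
- have [x0|x0] := pselect (exists x : X, True).
    by have [x _] := x0; have [u [h1 h2 h3]] := order_diff_dense_above f x e0; exists u.
  exists (scal _ 0); split => //.
    exact/order_diff_incl/order_preserving_scal.
  by move=> y; case: x0; exists y.
- by move=> A B AB [u [h1 h2 h3]]; exists u; split => // y /AB; exact: h3.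
- move=> A B [u [h1 h2 h3]] [v [k1 k2 k3]]; exists (Order.join u v); split.
  + exact: order_diffU.
  + by move=> y; rewrite cvalU gt_max h2 k2.
  + move=> y [/h3|/k3] h; apply: (lt_le_trans h); rewrite cvalU lerD2r le_max.
      by rewrite lexx.
    by rewrite lexx orbT.
move=> y; have [u [h1 h2 h3]] := order_diff_dense_above f y e0.
exists [set z | cval f z < cval u z + e]; last by exists u.
have := @near_lt_cval f (u + scal _ e) y; rewrite cvalD cval_scal h2 ltrDl.
by move=> /(_ e0); apply: filterS => z; rewrite cvalD cval_scal.
Qed.

End KakutaniStone.

(** * Ordered algebras modulo an l-ideal *)

Section LatticeAlgebra.
Variables (R : realType) (A : latAlgType R).
Implicit Types (a b c d m q : A) (r s t : R).

(** This takes the place of positivity in products. Where 0 <= 1 holds it implies 0 <= q, and in an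
    envelope it can be strictly stronger. *)
Definition multiplier q := forall b, 0 <= b -> 0 <= q * b.

(* The common properties of (A, reflexives prec) for (A, prec) in nbal and of
   (envelope S, range eps) for S in sbal.  In the latter case the product of two
   positive elements need not be positive, only that with a positive element of K. *)
Record ordered_by (K : set A) : Prop := OrderedBy {
  ob_lerD2r : forall a b c, a <= b -> a + c <= b + c;
  ob_scaler_ge0 : forall r a, 0 <= r -> 0 <= a -> 0 <= r *: a;
  ob_bounded : forall a, exists n : nat, (- n%:R : A) <= a <= n%:R;
  ob_multipliers : forall a,
    exists p q, [/\ multiplier p, multiplier q & a = p - q];
  ob_scal : forall r, K (scal A r);
  ob_add : forall a b, K a -> K b -> K (a + b);
  ob_join : forall a b, K a -> K b -> K (Order.join a b);
  ob_mul : forall a, K a -> 0 <= a -> multiplier a;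
  ob_dense : forall a r, 0 < r ->
    exists c d, [/\ K c, K d & labs (a - (c - d)) <= scal A r]
}.

Lemma scal_mul r a : scal A r * a = r *: a.
Proof. by rewrite -[LHS]la_scalerAl mul1r. Qed.

Lemma scalD r s : scal A (r + s) = scal A r + scal A s.
Proof. by rewrite /scal scalerDl. Qed.

Lemma scalB r s : scal A (r - s) = scal A r - scal A s.
Proof. by rewrite /scal scalerBl. Qed.

Lemma scal1 : scal A 1 = 1. Proof. exact: scale1r. Qed.
Lemma scal0 : scal A 0 = 0. Proof. exact: scale0r. Qed.
Lemma scalN r : scal A (- r) = - scal A r. Proof. exact: scaleNr. Qed.
Lemma scal_nat (n : nat) : scal A n%:R = n%:R. Proof. by rewrite /scal scaler_nat. Qed.
Lemma scalZ r s : r *: scal A s = scal A (r * s).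
Proof. by rewrite /scal scalerA. Qed.

Lemma labsN a : labs (- a) = labs a.
Proof. by rewrite /labs opprK joinC. Qed.

Lemma labs_le a b : (labs a <= b) = (a <= b) && (- a <= b).
Proof. exact: leUx. Qed.

Lemma le_labs a : a <= labs a. Proof. exact: leUl. Qed.
Lemma leN_labs a : - a <= labs a. Proof. exact: leUr. Qed.

(** Boundedness gives -n <= 1 <= n, hence 0 <= 2n, and the positive real 2n can be divided out. *)
Lemma one_ge0 : (forall a b c, a <= b -> a + c <= b + c) ->
  (forall r a, 0 <= r -> 0 <= a -> 0 <= r *: a) ->
  (forall a, exists n : nat, (- n%:R : A) <= a <= n%:R) -> (0 : A) <= 1.
Proof.
move=> lD lZ lB; have [[|n] /andP[h1 h2]] := lB 1; first by rewrite oppr0 in h1.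
have h : (0 : A) <= scal A (n.+1%:R + n.+1%:R).
  by rewrite scalD scal_nat -[leLHS](addNr n.+1%:R) lD //; exact: le_trans h2.
have n0 : 0 < n.+1%:R + n.+1%:R :> R by rewrite addr_gt0.
rewrite -scal1 -(mulVf (lt0r_neq0 n0)) -scalZ.
by apply: lZ => //; rewrite invr_ge0 ltW.
Qed.

Variable K : set A.
Hypothesis H : ordered_by K.

Lemma lmono a b c d : a <= b -> c <= d -> a + c <= b + d.
Proof.
move=> ab cd; apply: le_trans (ob_lerD2r H c ab) _.
by rewrite ![b + _]addrC; exact: (ob_lerD2r H).
Qed.

Lemma lsub_ge0 a b : (0 <= b - a) = (a <= b).
Proof.
apply/idP/idP => h; last by rewrite -(subrr a); exact: (ob_lerD2r H).
by have := ob_lerD2r H a h; rewrite add0r subrK.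
Qed.

Lemma loppr_le a b : a <= b -> - b <= - a.
Proof. by rewrite -lsub_ge0 -[- b <= _]lsub_ge0 opprK addrC. Qed.

Lemma loppr_ge0 a : (0 <= - a) = (a <= 0).
Proof. by rewrite -[- a]add0r lsub_ge0. Qed.

Lemma lscale r a b : 0 <= r -> a <= b -> r *: a <= r *: b.
Proof.
rewrite -(lsub_ge0 a) -(lsub_ge0 (r *: a)) -scalerBr => r0.
exact: (ob_scaler_ge0 H).
Qed.

Lemma lscale_ge0 r a : 0 <= r -> 0 <= a -> 0 <= r *: a.
Proof. exact: (ob_scaler_ge0 H). Qed.

Lemma ldouble_ge0 a : 0 <= a + a -> 0 <= a.
Proof.
move=> a0; have -> : a = 2^-1 *: (a + a).
  by rewrite -mulr2n -[a *+ 2]scaler_nat scalerA mulVf ?scale1r ?pnatr_eq0.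
by apply: lscale_ge0 => //; rewrite invr_ge0 ler0n.
Qed.

Lemma labs_ge0 a : 0 <= labs a.
Proof.
by apply: ldouble_ge0; rewrite -(subrr a); apply: lmono; [exact: le_labs|exact: leN_labs].
Qed.

Lemma labs_id a : 0 <= a -> labs a = a.
Proof.
move=> a0; apply/le_anti; rewrite le_labs andbT labs_le lexx /=.
by apply: (le_trans _ a0); rewrite -loppr_ge0 opprK.
Qed.

Lemma labsD a b : labs (a + b) <= labs a + labs b.
Proof.
rewrite labs_le opprD; apply/andP; split; apply: lmono;
  by [exact: le_labs | exact: leN_labs].
Qed.

Lemma ljoinDr a b c : Order.join a b + c = Order.join (a + c) (b + c).
Proof.
apply/le_anti; apply/andP; split; last by rewrite leUx !(ob_lerD2r H) ?leUl ?leUr.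
rewrite -[leRHS](subrK c); apply: (ob_lerD2r H).
rewrite leUx; apply/andP; split.
  by rewrite -[leLHS](addrK c); apply: (ob_lerD2r H); exact: leUl.
by rewrite -[leLHS](addrK c); apply: (ob_lerD2r H); exact: leUr.
Qed.

Lemma lmeetE a b : Order.meet a b = - Order.join (- a) (- b).
Proof.
apply/le_anti; apply/andP; split; last first.
  rewrite lexI -[X in _ <= X]opprK -[X in _ && (_ <= X)]opprK.
  by rewrite !loppr_le ?leUl ?leUr.
by rewrite -[leLHS]opprK loppr_le // leUx !loppr_le ?leIl ?leIr.
Qed.

Lemma lmeetDr a b c : Order.meet a b + c = Order.meet (a + c) (b + c).
Proof. by rewrite !lmeetE -[c]opprK -opprD ljoinDr !opprD !opprK. Qed.

Definition lpos a : A := Order.join a 0.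

Lemma lpos_ge0 a : 0 <= lpos a. Proof. exact: leUr. Qed.
Lemma lpos_ge a : a <= lpos a. Proof. exact: leUl. Qed.
Lemma lpos_le_labs a : lpos a <= labs a.
Proof. by rewrite leUx le_labs labs_ge0. Qed.

Lemma lposN a : lpos (- a) = lpos a - a.
Proof. by rewrite ljoinDr subrr add0r joinC. Qed.

Lemma lposBN a : lpos a - lpos (- a) = a.
Proof. by rewrite lposN subKr. Qed.

Lemma lpos_disjoint a : Order.meet (lpos a) (lpos (- a)) = 0.
Proof.
rewrite lposN -{1}[lpos a]addr0 ![lpos a + _]addrC -lmeetDr lmeetE oppr0 opprK.
by rewrite -/(lpos a) joinC -/(lpos a) addNr.
Qed.

Lemma lone_ge0 : (0 : A) <= 1.
Proof.
by apply: one_ge0; [exact: (ob_lerD2r H)|exact: (ob_scaler_ge0 H)|exact: (ob_bounded H)].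
Qed.

Lemma lscal_le r s : r <= s -> scal A r <= scal A s.
Proof.
move=> rs; rewrite -lsub_ge0 -scalB; apply: lscale_ge0 lone_ge0.
by rewrite subr_ge0.
Qed.

Lemma labs_bounded a : exists2 r : R, 0 <= r & labs a <= scal A r.
Proof.
have [n /andP[h1 h2]] := ob_bounded H a; exists n%:R; first exact: ler0n.
by rewrite labs_le scal_nat h2 -[leRHS]opprK loppr_le.
Qed.

Section Modulo.
Variable M : set A.
Hypothesis HM : l_ideal M.

Let M0 : M 0. Proof. by case: HM. Qed.
Let MD a b : M a -> M b -> M (a + b). Proof. by case: HM => _ + _ _; apply. Qed.
Let MM a b : M b -> M (a * b). Proof. by case: HM => _ _ + _; apply. Qed.
Let Mabs a b : labs a <= labs b -> M b -> M a.
Proof. by case: HM => _ _ _; apply. Qed.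

Lemma ideal_scale r a : M a -> M (r *: a).
Proof. by rewrite -scal_mul; exact: MM. Qed.

Lemma ideal_opp a : M a -> M (- a).
Proof. by rewrite -scaleN1r; exact: ideal_scale. Qed.

Lemma ideal_sub a b : M a -> M b -> M (a - b).
Proof. by move=> ha hb; apply: MD ha _; exact: ideal_opp. Qed.

Lemma ideal_convex a b : 0 <= a -> a <= b -> M b -> M a.
Proof.
move=> a0 ab; apply: Mabs; rewrite labs_id //.
exact: le_trans ab (le_labs b).
Qed.

Lemma ideal_labs a : M (labs a) <-> M a.
Proof.
by split; apply: Mabs; rewrite (labs_id (labs_ge0 a)).
Qed.

(* The preorder induced by the order of A / M. *)
Definition leM a b := exists2 m, M m & a <= b + m.

Lemma le_leM a b : a <= b -> leM a b.
Proof. by exists 0 => //; rewrite addr0. Qed.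

Lemma leM_trans a b c : leM a b -> leM b c -> leM a c.
Proof.
move=> [m hm ab] [n hn bc]; exists (n + m); first exact: MD.
by apply: le_trans ab _; rewrite addrA; exact: (ob_lerD2r H).
Qed.

Lemma leM_add a b c d : leM a b -> leM c d -> leM (a + c) (b + d).
Proof.
move=> [m hm ab] [n hn bc]; exists (m + n); first exact: MD.
by rewrite addrACA lmono.
Qed.

Lemma leM_scale r a b : 0 <= r -> leM a b -> leM (r *: a) (r *: b).
Proof.
move=> r0 [m hm ab]; exists (r *: m); first exact: ideal_scale.
by rewrite -scalerDr lscale.
Qed.

Lemma leM_mul q a b : multiplier q -> leM a b -> leM (q * a) (q * b).
Proof.
move=> hq [m hm ab]; exists (q * m); first exact: MM.
by rewrite -lsub_ge0 -mulrDr -mulrBr; apply: hq; rewrite lsub_ge0.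
Qed.

Lemma leM_join a b c : leM a c -> leM b c -> leM (Order.join a b) c.
Proof.
move=> [m hm ac] [n hn bc]; exists (labs m + labs n).
  by apply: MD; exact/ideal_labs.
rewrite leUx; apply/andP; split.
  apply: le_trans ac _; apply: lmono => //.
  by rewrite -[leLHS]addr0; apply: lmono; [exact: le_labs|exact: labs_ge0].
apply: le_trans bc _; apply: lmono => //.
by rewrite -[leLHS]add0r; apply: lmono; [exact: labs_ge0|exact: le_labs].
Qed.

Lemma leM_labs a b : leM a b -> leM (- a) b -> leM (labs a) b.
Proof. exact: leM_join. Qed.

Lemma leM0 a : leM (labs a) 0 -> M a.
Proof.
move=> [m hm]; rewrite add0r => h; apply/ideal_labs.
exact: ideal_convex (labs_ge0 a) h hm.
Qed.

Lemma leM_eq a b : M (a - b) -> leM a b.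
Proof. by exists (a - b) => //; rewrite addrC subrK. Qed.

Lemma leM_anti a b : leM a b -> leM b a -> M (a - b).
Proof.
have key u v : leM u v -> leM (u - v) 0.
  by move=> h; rewrite -(subrr v); apply: leM_add h _; exact: le_leM.
move=> /key ab /key ba; apply: leM0; apply: leM_labs => //.
by rewrite opprB.
Qed.

(** Replacement for |ab| <= |a||b|. If a multiplier p is at most r, then p t <= r t because t is a
    multiplier, and p times the positive or negative part of b is at most p t modulo [M]. The two
    parts account for [r + r]; for a difference of multipliers the constants add up. *)
Lemma leM_mul_labs a : exists2 r : R, 0 <= r &
  forall b (t : A), multiplier t -> leM (labs b) t -> leM (labs (a * b)) (r *: t).
Proof.
have key p : multiplier p -> exists2 r : R, 0 <= r & forall b (t : A),
    multiplier t -> leM (labs b) t -> leM (labs (p * b)) (r *: t).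
  move=> hp; have [r r0 hr] := labs_bounded p; exists (r + r); first exact: addr_ge0.
  move=> b t ht hb.
  have pt : p * t <= r *: t.
    rewrite -scal_mul -lsub_ge0 -mulrBl mulrC; apply: ht; rewrite lsub_ge0.
    exact: le_trans (le_labs p) hr.
  have hpos c : leM (labs c) t -> leM (p * lpos c) (r *: t).
    move=> hc; apply: leM_trans (le_leM pt); apply: leM_mul => //.
    exact: leM_trans (le_leM (lpos_le_labs c)) hc.
  rewrite -[b]lposBN mulrBr scalerDl.
  apply: leM_trans (le_leM (labsD _ _)) _; rewrite labsN.
  rewrite !labs_id; [|by apply: hp; exact: lpos_ge0..].
  by apply: leM_add; apply: hpos; rewrite ?labsN.
have [p [q [/key[r r0 hr] /key[s s0 hs] ->]]] := ob_multipliers H a.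
exists (r + s); first exact: addr_ge0.
move=> b t ht hb; rewrite mulrBl scalerDl.
apply: leM_trans (le_leM (labsD _ _)) _; rewrite labsN.
by apply: leM_add; [exact: hr|exact: hs].
Qed.

End Modulo.
End LatticeAlgebra.

(** * Real residues modulo a maximal l-ideal *)

Section MaximalIdeal.
Variables (R : realType) (A : latAlgType R) (K : set A).
Hypothesis H : ordered_by K.
Variable M : set A.
Hypothesis HM : maximal_l_ideal M.
Implicit Types (a b c k : A) (r s t : R).

Let HI : l_ideal M. Proof. by case: HM. Qed.
Let MD a b : M a -> M b -> M (a + b). Proof. by case: HI => _ + _ _; apply. Qed.
Let MM a b : M b -> M (a * b). Proof. by case: HI => _ _ + _; apply. Qed.
Let leMt := @leM_trans R A K H M HI.

Lemma maximal_not1 : ~ M 1.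
Proof.
case: HM => _ nT _ M1; apply: nT; apply/seteqP; split => // a _.
by rewrite -[a]mulr1; exact: MM.
Qed.

Lemma maximal_max J : l_ideal J -> M `<=` J -> ~ J 1 -> J = M.
Proof.
by case: HM => _ _ h hJ MJ J1; apply: h => // JT; apply: J1; rewrite JT.
Qed.

Lemma maximal_scal r : M (scal A r) -> r = 0.
Proof.
move=> h; apply: contrapT => /eqP r0; apply: maximal_not1.
rewrite -(scal1 A) -(mulVf r0) -scalZ; exact: ideal_scale.
Qed.

Lemma leM_scal r s : leM M (scal A r) (scal A s) -> r <= s.
Proof.
move=> [m hm h]; rewrite leNgt; apply/negP => sr.
have h' : scal A (r - s) <= m.
  by rewrite scalB -(lsub_ge0 H) opprB addrA [m + _]addrC (lsub_ge0 H).
have /eqP : r - s = 0.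
  apply: maximal_scal; apply: (ideal_convex H HI) h' hm.
  by rewrite -(scal0 A); apply: (lscal_le H); rewrite subr_ge0 ltW.
by rewrite subr_eq0 gt_eqF.
Qed.

(* The order ideal generated modulo M by a positive k in K is a ring ideal. *)
Lemma maximal_dichotomy k : K k -> 0 <= k ->
  M k \/ exists2 r, 0 <= r & leM M 1 (r *: k).
Proof.
move=> Kk k0; pose J : set A := [set b | exists2 r, 0 <= r & leM M (labs b) (r *: k)].
have hk : multiplier k by exact: (ob_mul H).
have hkr r : 0 <= r -> multiplier (r *: k).
  move=> r0 b b0; rewrite -scal_mul -mulrA scal_mul.
  by apply: (lscale_ge0 H) => //; exact: hk.
have JI : l_ideal J.
  split.
  - exists 0 => //; apply: le_leM => //.
    by rewrite (labs_id H) // scale0r.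
  - move=> a b [r r0 hr] [s s0 hs]; exists (r + s); first exact: addr_ge0.
    rewrite scalerDl; apply: leMt (le_leM HI (labsD H _ _)) _.
    exact: (leM_add H HI).
  - move=> a b [r r0 hr]; have [s s0 hs] := leM_mul_labs H HI a.
    exists (s * r); first exact: mulr_ge0.
    by rewrite -scalerA; apply: hs => //; exact: hkr.
  - move=> a b ab [r r0 hr]; exists r => //.
    exact: leMt (le_leM HI ab) hr.
have MJ : M `<=` J.
  move=> a Ma; exists 0 => //; exists (labs a); first exact/(ideal_labs H HI).
  by rewrite scale0r add0r.
have [J1|J1] := pselect (J 1); last first.
  left; rewrite -(maximal_max JI MJ J1); exists 1 => //.
  by rewrite scale1r (labs_id H) //; exact: le_leM.
right; case: J1 => r r0 h; exists r => //.
exact: leMt (le_leM HI (le_labs 1)) h.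
Qed.

(** The infinitesimals modulo [M] form an l-ideal that contains [M] and misses 1, so by maximality
    they are [M]. *)
Lemma infinitesimal_maximal b :
  (forall r, 0 < r -> leM M (labs b) (scal A r)) -> M b.
Proof.
pose J : set A := [set b | forall r, 0 < r -> leM M (labs b) (scal A r)].
have scal_mult r : 0 <= r -> multiplier (scal A r).
  by move=> r0 c c0; rewrite scal_mul; exact: (lscale_ge0 H).
have JI : l_ideal J.
  split.
  - move=> r r0; apply: le_leM => //; rewrite (labs_id H) // -(scal0 A).
    by apply: (lscal_le H); exact: ltW.
  - move=> a c ha hc r r0; rewrite (splitr r) scalD.
    have r2 : 0 < r / 2 by rewrite divr_gt0.
    apply: leMt (le_leM HI (labsD H _ _)) _.
    by apply: (leM_add H HI); [exact: ha|exact: hc].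
  - move=> a c hc r r0; have [s s0 hs] := leM_mul_labs H HI a.
    (* The [+ 1] keeps the divisor nonzero when s = 0. *)
    have s1 : 0 < s + 1 by rewrite ltr_wpDl.
    have rs : 0 < r / (s + 1) by rewrite divr_gt0.
    apply: leMt (hs c _ (scal_mult _ (ltW rs)) (hc _ rs)) _.
    rewrite scalZ; apply: le_leM => //; apply: (lscal_le H).
    by rewrite mulrCA ler_piMr ?ltW // ltr_pdivrMr // mul1r ltrDl.
  - by move=> a c ac hc r r0; exact: leMt (le_leM HI ac) (hc r r0).
have MJ : M `<=` J.
  move=> a Ma r r0; exists (labs a); first exact/(ideal_labs H HI).
  rewrite -[leLHS]add0r; apply: (lmono H) => //; rewrite -(scal0 A).
  by apply: (lscal_le H); exact: ltW.
have J1 : ~ J 1.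
  move=> /(_ 2^-1); rewrite invr_gt0 => /(_ (ltr0n _ 2)).
  rewrite (labs_id H) ?(lone_ge0 H) // -(scal1 A) => /leM_scal.
  by rewrite leNgt invf_lt1 // ltr1n.
by move=> Jb; have JM := maximal_max JI MJ J1; rewrite -JM.
Qed.

(* The negative part is disjoint from the positive part, hence it vanishes
   modulo M as soon as the positive part is bounded away from zero. *)
Lemma leM_pos_part a r : 0 < r -> leM M (scal A r) (lpos a) -> leM M 0 a.
Proof.
move=> r0 [m hm h]; pose z := lpos (- a); pose y := Order.meet z (scal A r).
have y0 : 0 <= y.
  rewrite lexI (lpos_ge0 (- a)) -(scal0 A) /=; apply: (lscal_le H); exact: ltW.
(* Each of the two parts of a, plus |m|, dominates y. Hence so does their meet plus |m|, which is
   |m| because the parts are disjoint. *)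
have yM : M y.
  apply: (ideal_convex H HI) y0 _ ((ideal_labs H HI m).2 hm).
  rewrite -[leRHS]add0r -(lpos_disjoint H a) (lmeetDr H) lexI; apply/andP; split.
    apply: le_trans (leIr _ _) _; apply: le_trans h _.
    by apply: (lmono H) => //; exact: le_labs.
  apply: le_trans (leIl _ _) _.
  by rewrite -[leLHS]addr0; apply: (lmono H) => //; exact: (labs_ge0 H).
(* The constant n satisfies n >= 1 and n r >= s, so that z <= n y and z inherits membership in [M]
   from its truncation y. *)
have [s s0 hs] := labs_bounded H z; pose n := s / r + 1.
have n1 : 1 <= n by rewrite lerDr divr_ge0 // ltW.
have n0 : 0 < n by exact: lt_le_trans ltr01 n1.
have zM : M z.
  apply: (ideal_convex H HI) (lpos_ge0 (- a)) _ (ideal_scale HI n yM).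
  rewrite -/z -[leLHS]scale1r -(mulfV (lt0r_neq0 n0)) -scalerA.
  apply: (lscale H) (ltW n0) _; rewrite lexI; apply/andP; split.
    rewrite -[leRHS]scale1r -(lsub_ge0 H) -scalerBl.
    by apply: (lscale_ge0 H) (lpos_ge0 _); rewrite subr_ge0 invf_le1.
  apply: le_trans (lscale H _ (le_trans (le_labs z) hs)) _.
    by rewrite invr_ge0 ltW.
  rewrite scalZ; apply: (lscal_le H); rewrite mulrC ler_pdivrMr // /n mulrDr.
  by rewrite mulr1 mulrC divfK ?lt0r_neq0 // lerDl ltW.
exists z => //; rewrite -[X in X + z](lposBN H) subrK; exact: lpos_ge0.
Qed.

Lemma leM_sub_scal a r : leM M 0 (a - scal A r) -> leM M (scal A r) a.
Proof.
move=> h; rewrite -[X in leM _ X _]add0r -[X in leM _ _ X](subrK (scal A r)).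
by apply: (leM_add H HI) h _; exact: le_leM.
Qed.

(** The dichotomy is applied to the positive part of k - r. If that part lies in [M], then k is at
    most r modulo [M]; otherwise it is bounded away from zero and [leM_pos_part] applies. *)
Lemma leM_total_K k r : K k -> leM M k (scal A r) \/ leM M (scal A r) k.
Proof.
move=> Kk; pose x := k - scal A r.
have Kx : K x by rewrite /x -scalN; apply: (ob_add H) => //; exact: (ob_scal H).
have Kp : K (lpos x) by rewrite /lpos -(scal0 A); apply: (ob_join H) => //; exact: (ob_scal H).
have [Mp|[s s0 hs]] := maximal_dichotomy Kp (lpos_ge0 x).
  left; exists (lpos x) => //; rewrite addrC -[leLHS](subrK (scal A r)).
  by apply: (lmono H) => //; exact: lpos_ge.
right; apply: leM_sub_scal; have s1 : 0 < s + 1 by rewrite ltr_wpDl.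
apply: (@leM_pos_part _ (s + 1)^-1); first by rewrite invr_gt0.
have := leM_scale H HI (ltW (etrans (invr_gt0 _) s1)) hs.
rewrite -(scal1 A) scalZ mulr1 scalerA => /leMt; apply; apply: le_leM => //.
rewrite -[leRHS]scale1r -(lsub_ge0 H) -scalerBl.
apply: (lscale_ge0 H) (lpos_ge0 _).
by rewrite subr_ge0 mulrC ler_pdivrMr // mul1r lerDl.
Qed.

(** The residue is the supremum of the cut of reals below [a] modulo [M]. Comparison is assumed only
    across a gap r < s because this weak form survives approximating [a]; it still makes [a] minus
    the supremum infinitesimal. *)
Lemma residue_sup a :
  (forall r s, r < s -> leM M a (scal A s) \/ leM M (scal A r) a) ->
  exists r, M (a - scal A r).
Proof.
move=> tot; pose E := [set t | leM M (scal A t) a].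
have [b b0 hb] := labs_bounded H a.
have E0 : E !=set0.
  exists (- b); apply: le_leM => //; rewrite scalN -[leRHS]opprK.
  by apply: (loppr_le H); exact: le_trans (leN_labs a) hb.
have Eb : has_ubound E.
  exists b => t /= ht; apply: leM_scal; apply: leMt ht _.
  by apply: le_leM => //; exact: le_trans (le_labs a) hb.
pose r := sup E; exists r; apply: infinitesimal_maximal => e e0.
apply: (leM_labs H HI).
  have lt : r + e / 2 < r + e by lra.
  have [h|h] := tot _ _ lt.
    rewrite addrC -[X in leM _ _ X](addKr (scal A r)) -scalD.
      by apply: (leM_add H HI) => //; exact: le_leM.
  have /(ub_le_sup Eb) : E (r + e / 2) by [].
  by rewrite -/r leNgt ltrDl divr_gt0.
have [t /= ht rt] := sup_adherent e0 (conj E0 Eb).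
rewrite opprB; have h : leM M (scal A (r - e)) a.
  by apply: leMt (le_leM HI _) ht; apply: (lscal_le H); exact: ltW.
rewrite -[X in leM _ _ X](addKr a) addrC.
apply: (leM_add H HI); first exact: le_leM.
rewrite -[scal A r](subrK (scal A e)) -scalB.
by apply: (leM_add H HI) h _; exact: le_leM.
Qed.

Lemma residue_ex a : exists r, M (a - scal A r).
Proof.
have resK k : K k -> exists r, M (k - scal A r).
  move=> Kk; apply: residue_sup => r s rs.
  have [h|h] := leM_total_K r Kk; [left|by right].
  by apply: leMt h (le_leM HI _); apply: (lscal_le H); exact: ltW.
apply: residue_sup => r s rs; pose e := (s - r) / 2.
have e0 : 0 < e by rewrite divr_gt0 // subr_gt0.
have [c [d [/resK[t ht] /resK[u hu] hcd]]] := ob_dense H a e0.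
have hM : M ((c - d) - scal A (t - u)).
  rewrite scalB; have -> : c - d - (scal A t - scal A u) =
    c - scal A t - (d - scal A u) by ring.
  exact: (ideal_sub HI).
(* Both s - e and r + e are the midpoint of r and s, so an approximation error of at most e keeps
   [a] on the side found for c - d. *)
have [le|lt] := leP (t - u) (s - e); [left|right].
  have -> : a = c - d + (a - (c - d)) by ring.
  have -> : scal A s = scal A (s - e) + scal A e by rewrite -scalD subrK.
  apply: (leM_add H HI); last by apply: le_leM => //; exact: le_trans (le_labs _) hcd.
  apply: leMt (leM_eq hM) _.
  by apply: le_leM => //; exact: (lscal_le H).
have le : r + e <= t - u by apply: ltW; apply: le_lt_trans lt; rewrite /e; lra.
have h1 : leM M (scal A (r + e)) (c - d).
  apply: leMt (le_leM HI (lscal_le H le)) _; apply: leM_eq.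
  by rewrite -opprB; exact: (ideal_opp HI).
have h2 : leM M (- scal A e) (a - (c - d)).
  apply: le_leM => //; rewrite -[leRHS]opprK; apply: (loppr_le H).
  exact: le_trans (leN_labs _) hcd.
have := leM_add H HI h1 h2.
by rewrite scalD addrK addrC subrK.
Qed.

End MaximalIdeal.

(** * The spectrum as a Nachbin space *)

Section Character.
Variables (R : realType) (A : latAlgType R).
Implicit Types (a b : A) (r : R) (chi : A -> R).

Record character chi : Prop := Character {
  chD : forall a b, chi (a + b) = chi a + chi b;
  chZ : forall r a, chi (r *: a) = r * chi a;
  chM : forall a b, chi (a * b) = chi a * chi b;
  ch1 : chi 1 = 1;
  chU : forall a b, chi (Order.join a b) = Num.max (chi a) (chi b)
}.

Variable chi : A -> R.
Hypothesis hchi : character chi.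

Lemma chN a : chi (- a) = - chi a.
Proof. by rewrite -scaleN1r (chZ hchi) mulN1r. Qed.

Lemma chB a b : chi (a - b) = chi a - chi b.
Proof. by rewrite (chD hchi) chN. Qed.

Lemma ch_scal r : chi (scal A r) = r.
Proof. by rewrite (chZ hchi) (ch1 hchi) mulr1. Qed.

Lemma ch0 : chi 0 = 0. Proof. by rewrite -(scal0 A) ch_scal. Qed.

Lemma ch_le a b : a <= b -> chi a <= chi b.
Proof. by move=> /join_idPr <-; rewrite (chU hchi) le_max lexx. Qed.

Lemma ch_labs a : chi (labs a) = `|chi a|.
Proof. by rewrite (chU hchi) chN maxrN. Qed.

(** Since a - chi a is in the kernel, an l-ideal containing the kernel and some a with chi a <> 0
    contains the nonzero real chi a, hence everything. *)
Lemma character_kernel : maximal_l_ideal [set a | chi a = 0].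
Proof.
have KI : l_ideal [set a | chi a = 0].
  split => /=.
  - by rewrite -(scale0r (1 : A)) ch_scal.
  - by move=> a b a0 b0; rewrite (chD hchi) a0 b0 addr0.
  - by move=> a b b0; rewrite (chM hchi) b0 mulr0.
  - move=> a b /ch_le; rewrite !ch_labs => /[swap] ->.
    by rewrite normr0 normr_le0 => /eqP.
split => //.
  move=> /seteqP[_ /(_ 1 I)] /= /eqP; rewrite (ch1 hchi).
  by rewrite oner_eq0.
move=> J [_ JD JM Jabs] JT KJ; apply/seteqP; split => // a Ja /=.
apply: contrapT => /eqP a0; apply: JT; apply/seteqP; split => // b _.
have Js : J (scal A (chi a)).
  have -> : scal A (chi a) = a + (- 1) * (a - scal A (chi a)) by ring.
  apply: JD => //; apply: JM; apply: KJ.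
  by rewrite /= chB ch_scal subrr.
have -> : b = ((chi a)^-1 *: b) * scal A (chi a).
  by rewrite mulrC scal_mul scalerA mulfV // scale1r.
exact: JM.
Qed.

Definition char_point : spec A := exist _ _ character_kernel.

End Character.

(** * Topology and compactness of the spectrum *)

Section SpectrumTopology.
Variables (R : realType) (A : latAlgType R) (K : set A).
Hypothesis H : ordered_by K.
Implicit Types (a b : A) (r s : R) (x y : spec A).

Let mx x : maximal_l_ideal (sval x). Proof. exact: svalP. Qed.
Let ix x : l_ideal (sval x). Proof. by case: (mx x). Qed.
Let xD x a b : sval x a -> sval x b -> sval x (a + b).
Proof. by case: (ix x) => _ + _ _; apply. Qed.
Let xM x a b : sval x b -> sval x (a * b).
Proof. by case: (ix x) => _ _ + _; apply. Qed.
Let xabs x a b : labs a <= labs b -> sval x b -> sval x a.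
Proof. by case: (ix x) => _ _ _; apply. Qed.

Lemma phi_valP a x : residue_at a x (phi_val a x).
Proof. exact: (xgetPex 0 (residue_ex H (mx x) a)). Qed.

Lemma residue_uniq a x r s : residue_at a x r -> residue_at a x s -> r = s.
Proof.
move=> hr hs; apply/eqP; rewrite -subr_eq0; apply/eqP.
apply: (maximal_scal (mx x)); rewrite scalB.
have -> : scal A r - scal A s = a - scal A s - (a - scal A r) by ring.
exact: (ideal_sub (ix x)).
Qed.

Lemma phi_val_eq a x r : residue_at a x r -> phi_val a x = r.
Proof. by move=> h; apply: residue_uniq (phi_valP a x) h. Qed.

Lemma residue_exuniq a x : exists! r, residue_at a x r.
Proof.
exists (phi_val a x); split; first exact: phi_valP.
by move=> r; exact: phi_val_eq.
Qed.

Lemma phi_character x : character ((@phi_val R A)^~ x).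
Proof.
have le_phi a : leM (sval x) a (scal A (phi_val a x)).
  by apply: leM_eq; exact: phi_valP.
have phi_le a : leM (sval x) (scal A (phi_val a x)) a.
  by apply: leM_eq; rewrite -opprB; apply: (ideal_opp (ix x)); exact: phi_valP.
have join_le a b : phi_val a x <= phi_val b x ->
    phi_val (Order.join a b) x = phi_val b x.
  move=> ab; apply: phi_val_eq; apply: (leM_anti H (ix x)).
    apply: (leM_join H (ix x)); last exact: le_phi.
    apply: (leM_trans H (ix x)) (le_phi a) _.
    by apply: (le_leM (ix x)); exact: (lscal_le H).
  exact: (leM_trans H (ix x) (phi_le b) (le_leM (ix x) (leUr _ _))).
split.
- move=> a b; apply: phi_val_eq; rewrite /residue_at scalD opprD addrACA.
  by apply: xD; exact: phi_valP.
- move=> r a; apply: phi_val_eq; rewrite /residue_at -scalZ -scalerBr.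
  by apply: (ideal_scale (ix x)); exact: phi_valP.
- move=> a b; apply: phi_val_eq; rewrite /residue_at -scalZ -scal_mul.
  set r := phi_val a x; set s := phi_val b x.
  have -> : a * b - scal A r * scal A s =
    b * (a - scal A r) + scal A r * (b - scal A s) by ring.
  by apply: xD; apply: xM; exact: phi_valP.
- by apply: phi_val_eq; rewrite /residue_at scal1 subrr; case: (ix x).
- move=> a b; case: (leP (phi_val a x) (phi_val b x)) => [|/ltW] ab.
    exact: join_le.
  by rewrite joinC join_le.
Qed.

Lemma spec_kerE x a : sval x a <-> phi_val a x = 0.
Proof.
split=> [h|h]; first by apply: phi_val_eq; rewrite /residue_at scal0 subr0.
by have := phi_valP a x; rewrite h /residue_at scal0 subr0.
Qed.

Lemma spec_ext x y : (forall a, phi_val a x = phi_val a y) -> x = y.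
Proof.
move=> h; have : sval x = sval y.
  by apply/seteqP; split => a /spec_kerE ha; apply/spec_kerE; rewrite -ha h.
case: x y {h} => [x hx] [y hy] /= xy; subst y.
by congr exist; exact: Prop_irrelevance.
Qed.

Lemma phi_char_point (chi : A -> R) (hchi : character chi) a :
  phi_val a (char_point hchi) = chi a.
Proof.
by apply: phi_val_eq; rewrite /residue_at /= (chB hchi) (ch_scal hchi) subrr.
Qed.

Lemma l_ideal_bigcap (F : set (spec A)) :
  l_ideal [set a | forall x, F x -> sval x a].
Proof.
split => /=.
- by move=> x _; case: (ix x).
- by move=> a b ha hb x Fx; apply: xD; [exact: ha|exact: hb].
- by move=> a b hb x Fx; apply: xM; exact: hb.
- by move=> a b ab hb x Fx; apply: xabs ab _; exact: hb.
Qed.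

(** The intersection [I] of all points containing a serves in place of the l-ideal generated by a: a
    point contains [I] exactly when it contains a. *)
Lemma spec_open_basis a : open [set x : spec A | ~ sval x a].
Proof.
pose I := [set b | forall x, sval x a -> sval x b].
have hI : l_ideal I := l_ideal_bigcap [set x | sval x a].
have -> : [set x : spec A | ~ sval x a] = ~` [set x : spec A | I `<=` sval x].
  apply/seteqP; split => x /=; apply: contra_not => h; first exact: h.
  by move=> b; apply.
exists [set ~` [set x : spec A | I `<=` sval x]]; last by rewrite bigcup_set1.
move=> _ ->; exists [fset I]%fset.
  by move=> J /fset1P ->; rewrite inE.
by rewrite set_fset1 bigcap_set1.
Qed.

(** The subbase reduces to a base because residues are real: the meet of |a| and |b| lies in a point
    only if a or b does. Finitely many conditions thus merge into one element, starting from 1 for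
    the empty intersection. *)
Lemma spec_nbhsP y (U : set (spec A)) :
  nbhs y U <-> exists2 a, ~ sval y a & forall x, ~ sval x a -> U x.
Proof.
split=> [|[a ya aU]]; last first.
  by rewrite nbhsE; exists [set x : spec A | ~ sval x a] => //; split => //;
    exact: spec_open_basis.
rewrite nbhsE => -[V [[D Dsub <-] [B DB By]] BU].
have [s ssub Bs] := Dsub _ DB.
have {}BU : B `<=` U by move=> x Bx; apply: BU; exists B.
suff [a ya ha] : exists2 a, ~ sval y a &
    forall x, ~ sval x a -> forall I, I \in enum_fset s -> ~ I `<=` sval x.
  exists a => // x /ha h; apply: BU; rewrite -Bs => I Is; exact: h.
have {}By I : I \in enum_fset s -> ~ I `<=` sval y.
  by move=> Is; move: By; rewrite -Bs => /(_ I Is).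
elim: (enum_fset s) By => [|I l IH] hy {ssub Bs}.
  by exists 1 => //; exact: (maximal_not1 (mx y)).
have [|a ya ha] := IH; first by move=> J Jl; apply: hy; rewrite inE Jl orbT.
have : ~ I `<=` sval y by apply: hy; rewrite inE eqxx.
move=> /existsNP[b /not_implyP[Ib yb]].
exists (Order.meet (labs a) (labs b)).
  move=> /spec_kerE; rewrite (lmeetE H) (chN (phi_character y)).
  rewrite (chU (phi_character y)) !(chN (phi_character y)).
  rewrite !(ch_labs (phi_character y)) => /eqP; rewrite oppr_eq0 => /eqP h.
  have := le_refl (0 : R); rewrite -{1}h ge_max !oppr_le0 !normr_ge0 => _.
  move: h; case: (leP (- `|phi_val a y|) (- `|phi_val b y|)) => _ /eqP;
    rewrite oppr_eq0 normr_eq0 => /eqP /spec_kerE //.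
have m0 : 0 <= Order.meet (labs a) (labs b) by rewrite lexI !(labs_ge0 H).
move=> x hx J; rewrite inE => /orP[/eqP->|Jl].
  move=> Ix; apply: hx; apply: (ideal_convex H (ix x)) m0 (leIr _ _) _.
  by apply/(ideal_labs H (ix x)); exact: Ix.
apply: ha => // xa; apply: hx.
apply: (ideal_convex H (ix x)) m0 (leIl _ _) _.
exact/(ideal_labs H (ix x)).
Qed.

Lemma spec_closedP : spec_closed_sets A.
Proof.
move=> F; split=> [cF|[I hI ->]].
  exists [set a | forall x, F x -> sval x a]; first exact: l_ideal_bigcap.
  apply/seteqP; split => x; first by move=> Fx a; apply.
  move=> hx; apply: contrapT => nFx.
  have /spec_nbhsP[a xa aF] : nbhs x (~` F).
    by apply: open_nbhs_nbhs; split => //; exact: closed_openC.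
  by apply: xa; apply: hx => z Fz; apply: contrapT => /aF.
rewrite -[X in closed X]setCK; apply: open_closedC; rewrite openE => x /= hx.
move: hx => /existsNP[a /not_implyP[Ia xa]]; apply/spec_nbhsP; exists a => //.
by move=> z za; apply: contra_not za; apply.
Qed.

Lemma phi_val_continuous a : continuous (phi_val a : spec A -> R).
Proof.
move=> y; apply/(@cvgrPdist_lt _ _ _ _ (nbhs_filter y)) => e e0.
set r := phi_val a y.
(* A bump function: b is nonzero exactly at the points where |a - r| < e. *)
pose b : A := lpos (scal A e - labs (a - scal A r)).
have hb x : phi_val b x = Num.max (e - `|phi_val a x - r|) 0.
  rewrite (chU (phi_character x)) (chB (phi_character x)).
  rewrite (ch_scal (phi_character x)) (ch_labs (phi_character x)).
  by rewrite (chB (phi_character x)) (ch_scal (phi_character x))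
    (ch0 (phi_character x)).
apply/spec_nbhsP; exists b => [/spec_kerE|x xb].
  rewrite hb subrr normr0 subr0 => h; move: e0.
  by rewrite ltNge -h le_max lexx.
rewrite distrC ltNge; apply/negP => h; apply: xb; apply/spec_kerE.
by rewrite hb; apply/max_idPr; rewrite subr_le0.
Qed.

Lemma spec_compact : compact [set: spec A].
Proof.
rewrite compact_ultra => F FU _.
have lim a : exists r : R, phi_val a x @[x --> F] --> r.
  have [b b0 hb] := labs_bounded H a.
  have bnd x : phi_val a x \in `[- b, b]%R.
    rewrite in_itv /= -ler_norml -(ch_labs (phi_character x)).
    by rewrite -[leRHS](ch_scal (phi_character x)); apply: (ch_le (phi_character x)).
  have FF : ProperFilter (phi_val a @ F) by exact: fmap_proper_filter.
  have [|r [_ clr]] := segment_compact (a := - b) (b := b) (F := phi_val a @ F) FF.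
    by apply: (@filterE _ F) => x; exact: bnd.
  exists r => U rU.
  (* An ultrafilter converges to its cluster points, since otherwise it would contain the complement
     of a neighbourhood. *)
  case: (in_ultra_setVsetC (phi_val a @^-1` U) FU) => // nU.
  by have [t []] := clr (~` U) U nU rU.
have [chi hlim] := choice lim.
have uniq a r : phi_val a x @[x --> F] --> r -> chi a = r.
  exact: (cvg_unique (@Rhausdorff R) (hlim a)).
have hchi : character chi.
  split.
  - move=> a b; apply: uniq.
    under eq_fun => x do rewrite (chD (phi_character x)).
    by apply: cvgD; exact: hlim.
  - move=> r a; apply: uniq.
    under eq_fun => x do rewrite (chZ (phi_character x)).
    by apply: cvgM; [exact: cvg_cst|exact: hlim].
  - move=> a b; apply: uniq.
    under eq_fun => x do rewrite (chM (phi_character x)).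
    by apply: cvgM; exact: hlim.
  - apply: uniq; under eq_fun => x do rewrite (ch1 (phi_character x)).
    exact: cvg_cst.
  - move=> a b; apply: uniq.
    under eq_fun => x do rewrite (chU (phi_character x)) maxr_absE.
    rewrite maxr_absE; apply: cvgM; last exact: cvg_cst.
    apply: cvgD; first by apply: cvgD; exact: hlim.
    by apply: cvg_norm; apply: cvgB; exact: hlim.
exists (char_point hchi); split => // U /spec_nbhsP[a /= a0 aU].
have nz : \forall x \near F, phi_val a x != 0.
  apply: (@cvgr_neq0 _ _ _ _ _ (phi_val a) (chi a) (hlim a)).
  exact/eqP.
by apply: filterS nz => x /eqP h; apply: aU => /spec_kerE.
Qed.

(** The difference c - d has equal values at both points and is within e / 3 of a, so the distance e
    between the two values of a would be at most 2 e / 3. *)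
Lemma phi_val_sep x y : (forall k, K k -> phi_val k x = phi_val k y) -> x = y.
Proof.
move=> h; apply: spec_ext => a; apply/eqP; rewrite -subr_eq0 -normr_le0 leNgt; apply/negP; set e := `|_| => e0.
have e3 : 0 < e / 3 by rewrite divr_gt0.
have [c [d [Kc Kd hcd]]] := ob_dense H a e3.
have key z : `|phi_val a z - (phi_val c z - phi_val d z)| <= e / 3.
  have := ch_le (phi_character z) hcd.
  by rewrite (ch_labs (phi_character z)) !(chB (phi_character z))
    (ch_scal (phi_character z)).
have := key x; have := key y; rewrite (h c Kc) (h d Kd).
move: (phi_val c y - phi_val d y) => t h1 h2.
have : e <= e / 3 + e / 3.
  have eE : e = `|(phi_val a x - t) - (phi_val a y - t)|.
    by rewrite /e opprB addrA subrK.
  by rewrite [leLHS]eE; exact: le_trans (ler_normB _ _) (lerD h2 h1).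
by apply/negP; rewrite -ltNge; lra.
Qed.

End SpectrumTopology.

Section SpectrumOrder.
Variables (R : realType) (A : latAlgType R) (prec : A -> A -> Prop).
Hypothesis H : ordered_by (reflexives prec).
Implicit Types (x y : spec A).

(** For the forward direction, c is the positive part of k - k(y). It is reflexive and vanishes at
    y, so it vanishes at x, which says k(x) <= k(y). *)
Lemma spec_leP x y : spec_le prec x y <->
  forall k, prec k k -> phi_val k x <= phi_val k y.
Proof.
have hx := phi_character H x; have hy := phi_character H y.
split=> [xy k kk|xy a [c [yc cc c0 ac]]]; last first.
  apply/(spec_kerE H)/eqP; rewrite -normr_le0 -(ch_labs hx).
  apply: le_trans (ch_le hx ac) _; apply: le_trans (xy c cc) _.
  by rewrite ((spec_kerE H y c).1 yc).
pose t := phi_val k y; pose c : A := lpos (k - scal A t).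
have kc : reflexives prec c.
  rewrite /c /lpos -(scal0 A) -scalN; apply: (ob_join H); last exact: (ob_scal H).
  by apply: (ob_add H) => //; exact: (ob_scal H).
have hc z : phi_val c z = Num.max (phi_val k z - t) 0.
  have hz := phi_character H z.
  by rewrite (chU hz) (chB hz) (ch_scal hz) (ch0 hz).
have /(spec_kerE H) : sval x c.
  apply: xy; exists c; split => //; last by rewrite (labs_id H) ?lpos_ge0.
    by apply/(spec_kerE H); rewrite hc subrr maxxx.
  exact: lpos_ge0.
by rewrite hc => /max_idPr; rewrite subr_le0.
Qed.

Lemma spec_nachbin : nachbin_axioms (spec_le prec).
Proof.
split.
- exact: spec_compact H.
- by move=> x; apply/spec_leP.
- move=> x y /spec_leP xy /spec_leP yx; apply: (phi_val_sep H) => k kk.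
  by apply/le_anti; rewrite xy ?yx.
- move=> x y z /spec_leP xy /spec_leP yz; apply/spec_leP => k kk.
  exact: le_trans (xy k kk) (yz k kk).
have -> : [set p : spec A * spec A | spec_le prec p.1 p.2] =
    \bigcap_(k in reflexives prec)
      ((fun p : spec A * spec A => phi_val k p.2 - phi_val k p.1) @^-1`
        [set r | 0 <= r]).
  apply/seteqP; split => p /=.
    by move=> /spec_leP h k kk /=; rewrite subr_ge0; exact: h.
  by move=> h; apply/spec_leP => k kk; rewrite -subr_ge0; exact: h.
apply: closed_bigI => k _; apply: preimage_closed; last exact: closed_ge.
move=> p _; apply: cvgB.
  apply: (@continuous_comp _ _ _ snd (phi_val k)); first exact: cvg_snd.
  exact: (phi_val_continuous H).
apply: (@continuous_comp _ _ _ fst (phi_val k)); first exact: cvg_fst.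
exact: (phi_val_continuous H).
Qed.

End SpectrumOrder.

(** * The algebras of nbal and the envelopes of sbal *)

Section NbalOrdered.
Variables (R : realType) (A : nbal R).
Implicit Types (a b : A).

Lemma nbal_proximity : reflexive_proximity (@nbal_prec R A).
Proof. by case: (nbal_ax A). Qed.

Lemma nbal_ordered : ordered_by (reflexives (@nbal_prec R A)).
Proof.
have [lD lM lZ lB _] := bal_ax A; have P := nbal_proximity.
have one0 : (0 : A) <= 1 := one_ge0 lD lZ lB.
split=> //.
- move=> a; exists (Order.join a 0), (Order.join a 0 - a); split.
  + by move=> b b0; apply: lM => //; exact: leUr.
  + by move=> b b0; apply: lM => //; rewrite -(subrr a) lD // leUl.
  + by rewrite subKr.
- exact: prox_scalar P.
- by move=> a b ha hb; exact: (prox_add P).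
- move=> a b ha hb; apply: (prox_join P).
    by apply: (prox_le_trans P (lexx a) ha); exact: leUl.
  by apply: (prox_le_trans P (lexx b) hb); exact: leUr.
- by move=> a _ a0 b b0; exact: lM.
move=> a r r0; have [_ /(_ a r r0)[c [d [hc hd]]]] := nbal_ax A.
(* Boundedness makes the set defining [unorm] nonempty; an infimum below r is then undercut by an
   actual bound s < r. *)
have [n /andP[h1 h2]] := lB (a - (c - d)).
move=> /inf_lt[|s /= hs sr].
  exists n%:R => /=; rewrite scal_nat leUx h2 /=.
  have := lD _ _ (n%:R - (a - (c - d))) h1.
  by rewrite addKr addrCA subrr addr0.
exists c, d; split => //; apply: le_trans hs _.
rewrite -[leLHS]add0r -(subrK s r) scalD; apply: lD.
by apply: lZ => //; rewrite subr_ge0 ltW.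
Qed.

End NbalOrdered.

Section EnvelopeOrdered.
Variables (R : realType) (S : sbal R).
Implicit Types (s t : S) (a b c d : cone S) (r : R) (x y z : envelope S).

Lemma env_cclP x : exists a b, x = ccl a b.
Proof. by exists (env_rep x).1, (env_rep x).2; rewrite env_repP. Qed.

Lemma ccl_le a b c d :
  ((ccl a b : envelope S) <= ccl c d) = (sval (a + d) <= sval (b + c)).
Proof. exact: env_leE. Qed.

Lemma ccl_addE a b c d : (ccl a b + ccl c d : envelope S) = ccl (a + c) (b + d).
Proof. exact: env_addE. Qed.

Lemma ccl_oppE a b : (- ccl a b : envelope S) = ccl b a.
Proof. exact: env_oppE. Qed.

Lemma ccl_mulE a b c d :
  (ccl a b * ccl c d : envelope S) = ccl (a * c + b * d) (a * d + b * c).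
Proof. exact: env_mulE. Qed.

Lemma ccl_scaleE r a b : 0 <= r ->
  (r *: (ccl a b : envelope S)) = ccl (cone_rho S r * a) (cone_rho S r * b).
Proof.
move=> r0; rewrite -[LHS]/(env_scale r (ccl a b)) /env_scale.
have := env_rep_ccl a b; case: (env_rep _) => a' b' /= h.
by rewrite r0; apply/cclP; rewrite -!mulrDr h.
Qed.

Lemma ccl_eps a b : ccl a b = eps (sval a) - eps (sval b) :> envelope S.
Proof.
rewrite -[eps (sval a)]/(ccl a 0) -[eps (sval b)]/(ccl b 0).
by rewrite ccl_oppE ccl_addE addr0 add0r.
Qed.

(** [s, 0] = [s + r, r] for large r brings s into the positive cone, where the formulas for the
    operations of the envelope apply. *)
Lemma eps_cone_sub s : exists a r, [/\ 0 <= r, sval a = s + rho r &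
  eps s = ccl a (cone_rho S r) :> envelope S].
Proof.
have [r r0 h] := shift_ge0 s; exists (exist _ (s + rho r) h), r; split => //.
by apply/clP; rewrite cone_rhoE //= add0r.
Qed.

Lemma eps_cl s t : eps s - eps t = cl s t :> envelope S.
Proof.
have [a [r [r0 ha ->]]] := eps_cone_sub s.
have [b [u [u0 hb ->]]] := eps_cone_sub t.
rewrite ccl_oppE ccl_addE; apply/clP.
rewrite -[sval (a + _)]/(sval a + sval (cone_rho S u)).
rewrite -[sval (_ + b)]/(sval (cone_rho S r) + sval b).
by rewrite ha hb !cone_rhoE // [RHS]addrC -!addrA [t + _]addrC.
Qed.

Lemma eps_le s t : ((eps s : envelope S) <= eps t) = (s <= t).
Proof.
have [a [r [r0 ha ->]]] := eps_cone_sub s.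
have [b [u [u0 hb ->]]] := eps_cone_sub t.
rewrite ccl_le -[sval (a + _)]/(sval a + sval (cone_rho S u)).
rewrite -[sval (_ + b)]/(sval (cone_rho S r) + sval b).
rewrite ha hb !cone_rhoE // [rho r + _]addrC -[t + _ + _]addrA [rho u + _]addrC.
by rewrite addrA -!addrA lm_lerD2r.
Qed.

Lemma eps0 : eps 0 = 0 :> envelope S. Proof. by []. Qed.

Lemma epsD s t : eps (s + t) = eps s + eps t :> envelope S.
Proof.
have [a [r [r0 ha ->]]] := eps_cone_sub s.
have [b [u [u0 hb ->]]] := eps_cone_sub t.
rewrite ccl_addE; apply/clP.
rewrite -[sval (cone_rho S r + _)]/(sval (cone_rho S r) + sval (cone_rho S u)).
rewrite -[sval (a + b)]/(sval a + sval b).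
by rewrite ha hb !cone_rhoE // add0r addrACA.
Qed.

Lemma eps_rho r : eps (rho r) = scal (envelope S) r.
Proof.
have pos u : 0 <= u -> eps (rho u) = scal (envelope S) u.
  move=> u0; rewrite /scal -[1]/(ccl 1 0) ccl_scaleE // mulr1 mulr0.
  by apply/clP; rewrite cone_rhoE // addrC.
have [r0|r0] := leP 0 r; first exact: pos.
have nr : 0 <= - r by rewrite oppr_ge0 ltW.
apply: (@addIr _ (eps (rho (- r)))); rewrite -epsD rho_oppK.
by rewrite pos // -scalD subrr scal0.
Qed.

(** Upper bounds are tested on differences: eps u <= eps c - eps d means u + d <= c, and adding d
    distributes over joins in [S]. *)
Lemma eps_join s t : eps (Order.join s t) = Order.join (eps s) (eps t).
Proof.
apply/le_anti; apply/andP; split; last by rewrite leUx !eps_le leUl leUr.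
have key z : (eps s : envelope S) <= z -> eps t <= z -> eps (Order.join s t) <= z.
  have [c [d ->]] := env_cclP z; rewrite ccl_eps.
  have sub u : ((eps u : envelope S) <= eps (sval c) - eps (sval d)) =
      (u + sval d <= sval c).
    have [a [r [r0 ha ->]]] := eps_cone_sub u.
    rewrite -ccl_eps ccl_le.
    rewrite -[sval (a + _)]/(sval a + sval d).
    rewrite -[sval (_ + c)]/(sval (cone_rho S r) + sval c).
    by rewrite ha cone_rhoE // addrAC [rho r + _]addrC lm_lerD2r.
  by rewrite !sub => h1 h2; rewrite lm_joinDl leUx h1.
by apply: key; [exact: leUl|exact: leUr].
Qed.

Lemma eps_meet s t : eps (Order.meet s t) = Order.meet (eps s) (eps t).
Proof.
apply/le_anti; apply/andP; split; first by rewrite lexI !eps_le leIl leIr.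
have key z : z <= (eps s : envelope S) -> z <= eps t -> z <= eps (Order.meet s t).
  have [c [d ->]] := env_cclP z; rewrite ccl_eps.
  have sub u : (eps (sval c) - eps (sval d) <= (eps u : envelope S)) =
      (sval c <= u + sval d).
    have [a [r [r0 ha ->]]] := eps_cone_sub u.
    rewrite -ccl_eps ccl_le.
    rewrite -[sval (c + _)]/(sval c + sval (cone_rho S r)).
    rewrite -[sval (_ + a)]/(sval d + sval a).
    by rewrite ha cone_rhoE // addrA [sval d + u]addrC lm_lerD2r.
  by rewrite !sub => h1 h2; rewrite lm_meetDl lexI h1.
by apply: key; [exact: leIl|exact: leIr].
Qed.

Lemma eps_mul a b : eps (sval (a * b)) = eps (sval a) * eps (sval b).
Proof.
rewrite -[eps (sval a)]/(ccl a 0) -[eps (sval b)]/(ccl b 0) ccl_mulE.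
by rewrite !mulr0 mul0r !addr0.
Qed.

Lemma sval_to_cone s : (0 : S) <= s -> sval (to_cone s) = s.
Proof. by move=> s0; rewrite /to_cone -[sval _]/(val _) insubdK. Qed.

Lemma eps_act r s : 0 <= r -> eps (act r s) = r *: eps s.
Proof.
move=> r0; rewrite /act; case: ifPn => [s0|_].
  rewrite -{2}(sval_to_cone s0) -[eps (sval (to_cone s))]/(ccl (to_cone s) 0).
  by rewrite ccl_scaleE // mulr0.
set t := xget _ _.
have [t0 h] : 0 <= t /\ (0 : S) <= s + rho t.
  apply: (@xgetPex _ 0 [set t : R | 0 <= t /\ (0 : S) <= s + rho t]).
  by have [u u0 hu] := shift_ge0 s; exists u.
have -> : eps s = ccl (to_cone (s + rho t)) (cone_rho S t).
  by apply/clP; rewrite sval_to_cone // cone_rhoE // add0r.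
rewrite ccl_scaleE // epsD eps_rho scalN -eps_rho -cone_rhoM //.
by rewrite ccl_eps [in RHS]cone_rhoE // mulr_ge0.
Qed.

Lemma env_prec_refl x : env_prec x x <-> exists s, x = eps s.
Proof.
split=> [[s /le_anti ->]|[s ->]]; first by exists s.
by exists s; rewrite lexx.
Qed.

Lemma env_ordered : ordered_by (reflexives (@env_prec R S)).
Proof.
have lD x y z : x <= y -> x + z <= y + z.
  have [a [b ->]] := env_cclP x; have [c [d ->]] := env_cclP y.
  have [e [f ->]] := env_cclP z.
  rewrite !ccl_addE !ccl_le => h; rewrite addrACA [b + f + _]addrACA.
  by rewrite [f + e]addrC cleD2r.
have ge0 a b : ((0 : envelope S) <= ccl a b) = (sval b <= sval a).
  by rewrite -[0 : envelope S]/(ccl 0 0) ccl_le !add0r.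
have mult a : multiplier (ccl a 0 : envelope S).
  move=> x; have [c [d ->]] := env_cclP x.
  rewrite ge0 ccl_mulE !mul0r !addr0 ge0 mulrC [a * c]mulrC => h.
  exact: cone_ler_mul.
split => //.
- move=> r x r0; have [c [d ->]] := env_cclP x; rewrite ccl_scaleE // !ge0.
  by rewrite mulrC [_ * c]mulrC; exact: cone_ler_mul.
- move=> x; have [a [b ->]] := env_cclP x.
  have [r r0 /andP[_ ha]] := sbal_bounded (sval a).
  have [u u0 /andP[_ hb]] := sbal_bounded (sval b).
  pose n := Num.bound (r + u).
  have rn : r + u < n%:R by apply: archi_boundP; exact: addr_ge0.
  have rho_le (v w : R) : v <= w -> (rho v : S) <= rho w.
    by move=> vw; apply/meet_idPl; rewrite -rho_meet; congr rho; apply/meet_idPl.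
  have bnd c v : v <= r + u -> sval c <= rho v -> forall d,
      sval c <= sval (d + cone_rho S n%:R).
    move=> vru hc d; apply: le_trans hc _.
    rewrite -[leRHS]/(sval d + sval (cone_rho S n%:R)) cone_rhoE ?ler0n //.
    rewrite -[leLHS]add0r; apply: le_trans (_ : rho v + sval d <= _).
      by rewrite [leRHS]addrC lm_lerD2r; exact: (svalP d).
    by rewrite [leRHS]addrC lm_lerD2r rho_le // (le_trans vru) // ltW.
  exists n; rewrite -scal_nat -eps_rho.
  rewrite -(cone_rhoE S (ler0n R n)) -[eps _]/(ccl (cone_rho S n%:R) 0).
  rewrite ccl_oppE !ccl_le !add0r addr0 [_ + a]addrC.
  by rewrite (bnd b u) ?lerDr // (bnd a r) // lerDl.
- move=> x; have [a [b ->]] := env_cclP x.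
  exists (ccl a 0), (ccl b 0); split => //.
  by rewrite ccl_oppE ccl_addE addr0 add0r.
- by move=> r; apply/env_prec_refl; exists (rho r); rewrite eps_rho.
- move=> _ _ /env_prec_refl[s ->] /env_prec_refl[t ->].
  by apply/env_prec_refl; exists (s + t); rewrite epsD.
- move=> _ _ /env_prec_refl[s ->] /env_prec_refl[t ->].
  by apply/env_prec_refl; exists (Order.join s t); rewrite eps_join.
- move=> _ /env_prec_refl[s ->]; rewrite -eps0 eps_le => s0.
  exact: (mult (exist _ s s0)).
(* Density holds with zero error, as each class is itself a difference of values of [eps]. *)
move=> x r r0; have [a [b ->]] := env_cclP x.
exists (eps (sval a)), (eps (sval b)); split.
- by apply/env_prec_refl; exists (sval a).
- by apply/env_prec_refl; exists (sval b).
rewrite -ccl_eps subrr leUx oppr0 andbb.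
rewrite -[scal _ _]eps_rho -eps0 eps_le rho_ge0 //; exact: ltW.
Qed.

End EnvelopeOrdered.

(** * Spectra and evaluation maps *)

Section SpectrumFunctor.
Variable R : realType.

Definition spec_nach (A : latAlgType R) (prec : A -> A -> Prop)
  (H : ordered_by (reflexives prec)) : nach := Nach (spec_nachbin H).

Lemma hom_character (A B : latAlgType R) (f : A -> B) (chi : B -> R) :
  is_latalg_hom f -> character chi -> character (chi \o f).
Proof.
move=> [fl [f1 fM] _ fU] h.
have fD a b : f (a + b) = f a + f b by have := fl 1 a b; rewrite !scale1r.
have f0 : f 0 = 0 by apply: (@addrI _ (f 0)); rewrite -fD !addr0.
split=> /=.
- by move=> a b; rewrite fD (chD h).
- by move=> r a; rewrite -[r *: a]addr0 fl f0 addr0 (chZ h).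
- by move=> a b; rewrite fM (chM h).
- by rewrite f1 (ch1 h).
- by move=> a b; rewrite fU (chU h).
Qed.

Section Map.
Variables (A B : latAlgType R) (pA : A -> A -> Prop) (pB : B -> B -> Prop).
Hypotheses (HA : ordered_by (reflexives pA)) (HB : ordered_by (reflexives pB)).
Variable f : A -> B.
Hypotheses (hf : is_latalg_hom f) (fp : forall a, pA a a -> pB (f a) (f a)).

(** Composing characters makes maximality of the new point automatic; [spec_mapE] identifies it with
    the preimage. *)
Definition spec_map (y : spec B) : spec A :=
  char_point (hom_character hf (phi_character HB y)).

Lemma phi_spec_map a y : phi_val a (spec_map y) = phi_val (f a) y.
Proof. exact: (phi_char_point HA). Qed.

Lemma spec_mapE y : sval (spec_map y) = f @^-1` sval y.
Proof. by apply/seteqP; split => a /(spec_kerE HB). Qed.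

Lemma spec_map_continuous : continuous (spec_map : spec_nach HB -> spec_nach HA).
Proof.
move=> y U /(spec_nbhsP HA)[a ya aU]; apply/(spec_nbhsP HB).
by rewrite spec_mapE in ya; exists (f a) => // x xa; apply: aU; rewrite spec_mapE.
Qed.

Lemma spec_map_homo x y : spec_le pB x y -> spec_le pA (spec_map x) (spec_map y).
Proof.
move=> /(spec_leP HB) xy; apply/(spec_leP HA) => k kk.
by rewrite !phi_spec_map; apply: xy; exact: fp.
Qed.

Definition spec_hom : nach_hom (spec_nach HB) (spec_nach HA) :=
  NachHom spec_map_continuous spec_map_homo.

End Map.

Section Unit.
Variables (A : latAlgType R) (prec : A -> A -> Prop).
Hypothesis H : ordered_by (reflexives prec).

Definition phi_map (a : A) : CX R (spec_nach H) :=
  Cfun (@phi_val_continuous R A _ H a : continuous (phi_val a : spec_nach H -> R)).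

Lemma phi_mapE a x : cval (phi_map a) x = phi_val a x. Proof. by []. Qed.

Lemma phi_map_hom : is_latalg_hom phi_map.
Proof.
split.
- move=> r a b; apply: CX_ext => x; have hx := phi_character H x.
  by rewrite cvalD cvalZ !phi_mapE (chD hx) (chZ hx).
- split; first by apply: CX_ext => x; exact: (ch1 (phi_character H x)).
  by move=> a b; apply: CX_ext => x; exact: (chM (phi_character H x)).
- move=> a b; apply: CX_ext => x; have hx := phi_character H x.
  rewrite cvalI !phi_mapE (lmeetE H) (chN hx) (chU hx) !(chN hx).
  by rewrite -oppr_min opprK.
- by move=> a b; apply: CX_ext => x; exact: (chU (phi_character H x)).
Qed.

Lemma phi_map_homo a : prec a a -> order_preserving (phi_map a).
Proof. by move=> aa x y /(spec_leP H); apply. Qed.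

End Unit.

(* A subalgebra of C(X) whose reflexive elements are the order preserving
   functions has X as its spectrum. *)
Section Evaluation.
Variables (X : nach) (A : latAlgType R) (prec : A -> A -> Prop).
Hypothesis H : ordered_by (reflexives prec).
Variable i : A -> CX R X.
Hypotheses (hi : is_latalg_hom i) (i_inj : forall a, i a = 0 -> a = 0).
Hypothesis i_homo : forall a, prec a a -> order_preserving (i a).
Hypothesis i_full : forall f, order_preserving f -> exists2 a, prec a a & i a = f.

Lemma cval_character (x : X) : character (fun f : CX R X => cval f x).
Proof. by []. Qed.

Definition eval_point (x : X) : spec A :=
  char_point (hom_character hi (cval_character x)).

Lemma phi_eval_point a x : phi_val a (eval_point x) = cval (i a) x.
Proof. exact: (phi_char_point H). Qed.

Lemma eval_point_continuous : continuous (eval_point : X -> spec_nach H).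
Proof.
move=> x U /(spec_nbhsP H)[a xa aU].
have : \forall z \near x, cval (i a) z != 0.
  apply: (@cvgr_neq0 _ _ _ _ _ (cval (i a)) (cval (i a) x)).
    exact: cts_fun.
  exact/eqP.
by apply: filterS => z /eqP za; exact: aU.
Qed.

Lemma eval_point_homo x y :
  nach_le x y -> spec_le prec (eval_point x) (eval_point y).
Proof.
move=> xy; apply/(spec_leP H) => k kk; rewrite !phi_eval_point.
exact: i_homo.
Qed.

Definition eval_hom : nach_hom X (spec_nach H) :=
  NachHom eval_point_continuous eval_point_homo.

Lemma eval_point_reflect x y :
  spec_le prec (eval_point x) (eval_point y) -> nach_le x y.
Proof.
move=> /(spec_leP H) xy; apply: contrapT => /(order_separation R)[f hf].
have [k kk <-] := i_full hf; rewrite ltNge -!phi_eval_point.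
by rewrite xy.
Qed.

Lemma eval_point_closed C : closed C -> closed [set eval_point x | x in C].
Proof.
move=> cC; apply: (@compact_closed (spec_nach H)); first exact: nach_hausdorff.
apply: (@continuous_compact _ (spec_nach H)).
  by apply: continuous_subspaceT => x; exact: eval_point_continuous.
case: (nach_ax X) => cX _ _ _ _.
by apply: subclosed_compact cC cX _.
Qed.

Lemma eval_point_surj (y : spec A) : exists x, eval_point x = y.
Proof.
apply: contrapT => ny.
have /(spec_nbhsP H)[a ya aE] : nbhs y (~` [set eval_point x | x in setT]).
  apply: open_nbhs_nbhs; split; last by move=> [x _ xy]; apply: ny; exists x.
  exact/closed_openC/eval_point_closed/closedT.
(* As a vanishes on [X], i a = 0 and so a = 0, while 0 belongs to every point. *)
apply: ya; rewrite (i_inj (a := a)); first by case: y {ny aE} => I [[]].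
apply: CX_ext => x; apply: contrapT => xa.
by apply: (aE (eval_point x) xa); exists x.
Qed.

(** Evaluation reflects the order, hence is injective by antisymmetry; being also a closed
    surjection, it has a continuous order preserving inverse. *)
Lemma eval_hom_iso : @is_iso Nachcat _ _ eval_hom.
Proof.
have [g gK] := choice eval_point_surj.
case: (nach_ax X) => _ lexx' anti _ _.
have Kg x : g (eval_point x) = x.
  by apply: anti; apply: eval_point_reflect; rewrite gK;
    case: (nach_ax (spec_nach H)) => _ + _ _ _; apply.
have gc : continuous (g : spec_nach H -> X).
  apply/continuous_closedP => C cC.
  have -> : g @^-1` C = [set eval_point x | x in C].
    apply/seteqP; split => [y Cy|_ [x Cx <-]]; first by exists (g y).
    by rewrite /preimage /= Kg.
  exact: eval_point_closed.
have gh x y : spec_le prec x y -> nach_le (g x) (g y).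
  by move=> xy; apply: eval_point_reflect; rewrite !gK.
exists (@NachHom (spec_nach H) X g gc gh).
by split; apply: nach_hom_ext => x; [exact: Kg|exact: gK].
Qed.

End Evaluation.
End SpectrumFunctor.

(** * Extending maps on a semialgebra to its envelope *)

Section EnvelopeExtension.
Variables (R : realType) (S : sbal R) (B : latAlgType R) (K : set B).
Hypothesis HK : ordered_by K.
Variable f : S -> B.
Hypotheses (fD : forall s t, f (s + t) = f s + f t)
  (fU : forall s t, f (Order.join s t) = Order.join (f s) (f t))
  (f1 : f (rho 1) = 1)
  (fM : forall a b : cone S, f (sval (a * b)) = f (sval a) * f (sval b))
  (f_act : forall r s, 0 <= r -> f (act r s) = r *: f s).

(** With a morphism followed by [eps] this gives [env_map], with [sval] it gives [env_incl], so one
    homomorphism proof serves both. The chosen representatives disappear through [env_ext_sub]. *)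
Definition env_ext (x : envelope S) : B :=
  f (sval (env_rep x).1) - f (sval (env_rep x).2).

Lemma env_ext_sub s t : env_ext (eps s - eps t) = f s - f t.
Proof.
rewrite /env_ext eps_cl; have := env_repP (cl s t).
case: (env_rep _) => a b /= /clP ab; apply/eqP.
by rewrite subr_eq addrAC eq_sym subr_eq -!fD ab addrC.
Qed.

Lemma env_subP (x : envelope S) : exists s t, x = eps s - eps t.
Proof. by have [a [b ->]] := env_cclP x; rewrite ccl_eps; exists (sval a), (sval b). Qed.

Let FD x y : env_ext (x + y) = env_ext x + env_ext y.
Proof.
have [s [t ->]] := env_subP x; have [s' [t' ->]] := env_subP y.
by rewrite addrACA -opprD -!epsD !env_ext_sub !fD opprD addrACA.
Qed.

Let FN x : env_ext (- x) = - env_ext x.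
Proof.
by have [s [t ->]] := env_subP x; rewrite opprB !env_ext_sub opprB.
Qed.

Let FU x y : env_ext (Order.join x y) = Order.join (env_ext x) (env_ext y).
Proof.
have [s [t ->]] := env_subP x; have [s' [t' ->]] := env_subP y.
have HS := env_ordered S.
have -> : Order.join (eps s - eps t) (eps s' - eps t') =
    eps (Order.join (s + t') (s' + t)) - eps (t + t').
  rewrite eps_join (ljoinDr HS) !epsD; congr Order.join; ring.
rewrite !env_ext_sub fU (ljoinDr HK) !fD; congr Order.join; ring.
Qed.

Lemma env_ext_hom : is_latalg_hom env_ext.
Proof.
have FZ r x : 0 <= r -> env_ext (r *: x) = r *: env_ext x.
  move=> r0; have [s [t ->]] := env_subP x.
  by rewrite scalerBr -!eps_act // !env_ext_sub !f_act // scalerBr.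
split=> //.
- move=> r x y; rewrite FD; congr (_ + _).
  have [r0|r0] := leP 0 r; first exact: FZ.
  rewrite -[r]opprK scaleNr FN FZ ?scaleNr //; first by rewrite oppr_ge0 ltW.
- split.
    have -> : (1 : envelope S) = eps (rho 1) - eps 0.
      by rewrite eps0 subr0 eps_rho scal1.
    have f0 : f 0 = 0 by apply: (@addrI _ (f 0)); rewrite -fD !addr0.
    by rewrite env_ext_sub f1 f0 subr0.
  move=> x y; have [a [b ->]] := env_cclP x; have [c [d ->]] := env_cclP y.
  rewrite ccl_mulE !ccl_eps !env_ext_sub.
  rewrite -[sval (a * c + _)]/(sval (a * c) + sval (b * d)).
  rewrite -[sval (a * d + _)]/(sval (a * d) + sval (b * c)).
  by rewrite !fD !fM; ring.
by move=> x y; rewrite (lmeetE (env_ordered S)) FN FU !FN (lmeetE HK).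
Qed.

End EnvelopeExtension.

(** * The two adjunctions *)

Section ConcreteProximity.
Variable R : realType.

(** If the set of bounds has no lower bound, as over the trivial algebra, [inf] takes its default 0;
    this is where 0 <= r enters. *)
Lemma unorm_le (A : latAlgType R) (a : A) (r : R) :
  0 <= r -> labs a <= scal A r -> unorm a <= r.
Proof.
move=> r0 ar; rewrite /unorm.
have [lb|/forallNP nlb] := pselect (has_lbound [set r : R | labs a <= scal A r]).
  exact: ge_inf lb _ ar.
by rewrite inf_out // => -[_ [z lb]]; exact: (nlb z).
Qed.

Lemma CX_nbal_axioms (X : nach) : nbal_axioms (@CX_prec R X).
Proof.
split; last first.
  (* Half of e, because a pointwise bound gives only a weak inequality for the infimum. *)
  move=> f e e0; have e2 : 0 < e / 2 by rewrite divr_gt0.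
  have [_ [g [h [hg hh ->]]] fgh] := order_diff_dense f e2.
  exists g, h; split; [by exists g|by exists h|].
  apply: (@le_lt_trans _ _ (e / 2)); last by rewrite ltr_pdivrMr // ltr_pMr // ltr1n.
  apply: unorm_le (ltW e2) _; apply/CX_leP => x; rewrite cval_scal cvalU.
  rewrite -[cval (- _) x]/(- cval (f - (g - h)) x) maxrN.
  exact/ltW/fgh.
split.
- by move=> f g [c [_ fc cg]]; exact: le_trans cg.
- move=> f g h k fg [c [hc gc ch]] hk; exists c.
  by split=> //; [exact: le_trans gc|exact: le_trans hk].
- move=> f g h [c [hc fc cg]] [d [hd fd dh]]; exists (Order.meet c d).
  split; [exact: order_preservingI|by rewrite lexI fc|].
  by rewrite lexI !leIx2 ?cg ?dh ?orbT.
- move=> f g h [c [hc fc ch]] [d [hd gd dh]]; exists (Order.join c d).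
  split; [exact: order_preservingU| |by rewrite leUx ch].
  by rewrite leUx !lexU2 ?fc ?gd ?orbT.
- move=> f g [c [hc fc cg]]; exists c.
  by split; [exists c|exists c|exists c].
- move=> f g h k [c [hc /CX_leP fc /CX_leP cg]] [d [hd /CX_leP hd' /CX_leP dk]].
  exists (c + d); split; first exact: order_preservingD.
    by apply/CX_leP => x; rewrite !cvalD lerD.
  by apply/CX_leP => x; rewrite !cvalD lerD.
- move=> f g h k /CX_leP f0 _ /CX_leP h0 _.
  move=> [c [hc /CX_leP fc /CX_leP cg]] [d [hd /CX_leP hd' /CX_leP dk]].
  (* Nonnegativity passes from f and h up to c and d, which makes their product order preserving. *)
  have c0 x : 0 <= cval c x by exact: le_trans (f0 x) (fc x).
  have d0 x : 0 <= cval d x by exact: le_trans (h0 x) (hd' x).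
  exists (c * d); split.
  + by move=> x y xy; rewrite !cvalM ler_pM ?hc ?hd.
  + by apply/CX_leP => x; rewrite !cvalM ler_pM //; [exact: f0|exact: h0].
  + by apply/CX_leP => x; rewrite !cvalM ler_pM.
- by move=> r; exists (scal _ r); split => //; exact: order_preserving_scal.
move=> f g r r0 [c [hc /CX_leP fc /CX_leP cg]].
exists (r *: c); split; first exact: order_preservingZ.
  by apply/CX_leP => x; rewrite !cvalZ ler_wpM2l.
by apply/CX_leP => x; rewrite !cvalZ ler_wpM2l.
Qed.

Definition CX_nbal (X : nach) : nbal R := Nbal (CX_nbal_axioms X).

Lemma CX_precP (X : nach) (f : CX R X) : CX_prec f f <-> order_preserving f.
Proof.
split=> [[c [hc fc cf]]|hf]; last by exists f.
by have -> : f = c by apply/le_anti; rewrite fc cf.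
Qed.

Section Pullback.
Variables (X Z : nach) (u : nach_hom X Z).

Fact pullback_continuous (g : CX R Z) : continuous (fun x => cval g (u x)).
Proof.
move=> x; apply: (@continuous_comp _ _ _ u (cval g)).
  exact: nach_fun_continuous.
exact: cts_fun.
Qed.

Definition pullback (g : CX R Z) : CX R X := Cfun (@pullback_continuous g).

Lemma pullback_hom : is_latalg_hom pullback.
Proof.
split; [move=> r f g|split=> [|f g]|move=> f g|move=> f g];
  exact: CX_ext.
Qed.

Lemma pullback_homo (g : CX R Z) : order_preserving g -> order_preserving (pullback g).
Proof. by move=> hg x y xy; apply: hg; exact: nach_fun_homo. Qed.

Lemma pullback_prec (f g : CX_nbal Z) :
  nbal_prec f g -> nbal_prec (pullback f : CX_nbal X) (pullback g).
Proof.
move=> [c [hc /CX_leP fc /CX_leP cg]]; exists (pullback c).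
by split; [exact: pullback_homo|apply/CX_leP => x..]; [exact: fc|exact: cg].
Qed.

Definition pullback_nbal : nbal_hom (CX_nbal Z) (CX_nbal X) :=
  @NbalHom R (CX_nbal Z) (CX_nbal X) pullback pullback_hom pullback_prec.

End Pullback.
End ConcreteProximity.

Section NbalAdjunction.
Variable R : realType.

Definition spec_nbal (A : nbal R) : nach := spec_nach (nbal_ordered A).

Definition spec_nbal_hom (A B : nbal R) (f : nbal_hom A B) :
    nach_hom (spec_nbal B) (spec_nbal A) :=
  spec_hom (nbal_ordered A) (nbal_ordered B) (nbal_fun_hom f)
    (fun a => @nbal_fun_prec R A B f a a).

(** Axiom RP5 puts a reflexive c between a and b, and the image of c is the order preserving
    function that [CX_prec] asks for. *)
Lemma phi_nbal_prec (A : nbal R) (a b : A) : nbal_prec a b ->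
  CX_prec (phi_map (nbal_ordered A) a) (phi_map (nbal_ordered A) b).
Proof.
move=> /(prox_refl_interp (nbal_proximity A))[c [ac cc cb]].
exists (phi_map (nbal_ordered A) c); split; first exact: phi_map_homo.
  by apply/CX_leP => x; apply: (ch_le (phi_character (nbal_ordered A) x));
    exact: (prox_le (nbal_proximity A)).
by apply/CX_leP => x; apply: (ch_le (phi_character (nbal_ordered A) x));
  exact: (prox_le (nbal_proximity A)).
Qed.

Definition phi_nbal (A : nbal R) : nbal_hom A (CX_nbal R (spec_nbal A)) :=
  @NbalHom R A (CX_nbal R (spec_nbal A)) _ (phi_map_hom (nbal_ordered A))
    (@phi_nbal_prec A).

Lemma id_latalg_hom (A : latAlgType R) : is_latalg_hom (@idfun A).
Proof. by []. Qed.

Definition eta_nbal (X : nach) : nach_hom X (spec_nbal (CX_nbal R X)) :=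
  @eval_hom R X (CX R X) _ (nbal_ordered (CX_nbal R X)) idfun
    (id_latalg_hom (CX R X)) (fun a => (CX_precP a).1).

Definition C_functor :
  @contrafunctor Nachcat (nbalcat R) (fun X => CX_nbal R X).
Proof.
apply: (@Contrafunctor Nachcat (nbalcat R) _ (fun X Z u => pullback_nbal R u)).
  by move=> X; apply: nbal_hom_ext => f; exact: CX_ext.
by move=> X Y Z g f; apply: nbal_hom_ext => h; exact: CX_ext.
Defined.

Definition X_functor : @contrafunctor (nbalcat R) Nachcat (fun A => spec_nbal A).
Proof.
apply: (@Contrafunctor (nbalcat R) Nachcat _ (fun A B f => spec_nbal_hom f)).
  move=> A; apply: nach_hom_ext => x; apply: (spec_ext (nbal_ordered A)) => a.
  exact: (phi_spec_map (nbal_ordered A)).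
move=> A B C g f; apply: nach_hom_ext => x; apply: (spec_ext (nbal_ordered A)) => a.
rewrite (phi_spec_map (nbal_ordered A)) [RHS](phi_spec_map (nbal_ordered A)).
by rewrite [RHS](phi_spec_map (nbal_ordered B)).
Defined.

Lemma nbal_adjunction :
  contravariant_adjunction C_functor X_functor phi_nbal eta_nbal.
Proof.
split.
- move=> A B f; apply: nbal_hom_ext => a; apply: CX_ext => x.
  by rewrite [RHS](phi_spec_map (nbal_ordered A)).
- move=> X Y u; apply: nach_hom_ext => x.
  apply: (spec_ext (nbal_ordered (CX_nbal R Y))) => g.
  rewrite [LHS](phi_eval_point (nbal_ordered (CX_nbal R Y))).
  rewrite [RHS](phi_spec_map (nbal_ordered (CX_nbal R Y))).
  by rewrite [RHS](phi_eval_point (nbal_ordered (CX_nbal R X))).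
- move=> X; apply: nbal_hom_ext => g; apply: CX_ext => x.
  exact: (phi_eval_point (nbal_ordered (CX_nbal R X))).
- move=> A; apply: nach_hom_ext => x; apply: (spec_ext (nbal_ordered A)) => a.
  rewrite [LHS](phi_spec_map (nbal_ordered A)).
  exact: (phi_eval_point (nbal_ordered (CX_nbal R (spec_nbal A)))).
Qed.

Lemma eta_nbal_iso (X : nach) : @is_iso Nachcat _ _ (eta_nbal X).
Proof.
apply: eval_hom_iso => // f hf; exists f => //; exact/CX_precP.
Qed.

End NbalAdjunction.

(** * The adjunction between Nachbin spaces and semialgebras *)

Section SbalAdjunction.
Variable R : realType.

Definition spec_sbal (S : sbal R) : nach := spec_nach (env_ordered S).

Lemma env_map_hom (S T : sbal R) (f : sbal_hom S T) : is_latalg_hom (env_map f).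
Proof.
have -> : env_map f = env_ext (fun s => eps (f s)).
  by apply/funext => x; rewrite /env_ext eps_cl.
apply: (env_ext_hom (env_ordered T)).
- by move=> s t; rewrite sbal_funD epsD.
- by move=> s t; rewrite sbal_funU eps_join.
- by rewrite sbal_fun1 eps_rho scal1.
- move=> a b; pose fa : cone T := exist _ (f (sval a)) (sbal_fun_ge0 f (svalP a)).
  pose fb : cone T := exist _ (f (sval b)) (sbal_fun_ge0 f (svalP b)).
  by rewrite (@sbal_funM _ _ _ f a b fa fb erefl erefl) eps_mul.
- by move=> r s r0; rewrite sbal_fun_act // eps_act.
Qed.

Lemma env_map_eps (S T : sbal R) (f : sbal_hom S T) (s : S) :
  env_map f (eps s) = eps (f s).
Proof.
have fD (u v : S) : eps (f (u + v)) = eps (f u) + eps (f v) :> envelope T.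
  by rewrite sbal_funD epsD.
have := env_ext_sub fD s 0; rewrite eps0 subr0 sbal_fun0 eps0 subr0 => <-.
by rewrite /env_ext eps_cl.
Qed.

Lemma env_map_prec (S T : sbal R) (f : sbal_hom S T) (x : envelope S) :
  env_prec x x -> env_prec (env_map f x) (env_map f x).
Proof.
move=> /env_prec_refl[s ->]; apply/env_prec_refl; exists (f s).
exact: env_map_eps.
Qed.

Definition spec_sbal_hom (S T : sbal R) (f : sbal_hom S T) :
    nach_hom (spec_sbal T) (spec_sbal S) :=
  spec_hom (env_ordered S) (env_ordered T) (env_map_hom f) (@env_map_prec S T f).

(** The reflexive elements of the envelope are the values of [eps], and they separate points;
    equalities between points of these spectra are therefore tested on such values only. *)
Lemma spec_eps_ext (S : sbal R) (x y : spec (envelope S)) :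
  (forall s : S, phi_val (eps s) x = phi_val (eps s) y) -> x = y.
Proof.
move=> h; apply: (phi_val_sep (env_ordered S)) => _ /env_prec_refl[s ->].
exact: h.
Qed.

(** The arbitrary shift t hidden in [act] cancels pointwise: r (g + t) - r t = r g. *)
Lemma cle_val_act (X : nach) (r : R) (g : Cle R X) (x : X) :
  0 <= r -> cle_val (act r g) x = r * cle_val g x.
Proof.
have mulE (a b : cone (Cle R X)) z :
  cle_val (sval (a * b)) z = cle_val (sval a) z * cle_val (sval b) z by [].
have rhoE (u : R) z : cle_val (rho u : Cle R X) z = u by [].
have addE (a b : Cle R X) z : cle_val (a + b) z = cle_val a z + cle_val b z by [].
move=> r0; rewrite /act; case: ifPn => [g0|_].
  by rewrite mulE cone_rhoE // rhoE sval_to_cone.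
set t := xget _ _.
have [t0 h] : 0 <= t /\ (0 : Cle R X) <= g + rho t.
  apply: (@xgetPex _ 0 [set t : R | 0 <= t /\ (0 : Cle R X) <= g + rho t]).
  by have [u u0 hu] := shift_ge0 g; exists u.
rewrite addE mulE cone_rhoE // sval_to_cone // addE !rhoE; ring.
Qed.

Section ClePullback.
Variables (X Z : nach) (u : nach_hom X Z).

Definition cle_pullback (g : Cle R Z) : Cle R X :=
  exist _ (pullback u (sval g)) (pullback_homo u (svalP g)).

Lemma cle_pullbackE g x : cle_val (cle_pullback g) x = cle_val g (u x).
Proof. by []. Qed.

Definition cle_pullback_hom : sbal_hom (Cle R Z) (Cle R X).
Proof.
apply: (@SbalHom R (Cle R Z) (Cle R X) cle_pullback).
- exact: cleP.
- by move=> f g; exact: cleP.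
- by move=> f g; exact: cleP.
- by move=> f g; exact: cleP.
- exact: cleP.
- move=> a b a' b' ha hb; apply: cleP => x.
  rewrite -[RHS]/(cle_val (sval a') x * cle_val (sval b') x) -ha -hb.
  by [].
- move=> r g r0; apply: cleP => x.
  by rewrite cle_val_act // !cle_pullbackE cle_val_act.
Defined.

End ClePullback.

Section Psi.
Variable S : sbal R.
Let H := env_ordered S.

Lemma psi_homo (s : S) : order_preserving (phi_map H (eps s)).
Proof. by apply: phi_map_homo; apply/env_prec_refl; exists s. Qed.

Definition psi_map (s : S) : Cle R (spec_sbal S) := exist _ _ (psi_homo s).

Lemma psi_mapE s x : cle_val (psi_map s) x = phi_val (eps s) x.
Proof. by []. Qed.

Definition psi_hom : sbal_hom S (Cle R (spec_sbal S)).
Proof.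
apply: (@SbalHom R S (Cle R (spec_sbal S)) psi_map).
- by apply: cleP => x; rewrite psi_mapE eps0 (ch0 (phi_character H x)).
- by move=> s t; apply: cleP => x; rewrite psi_mapE epsD (chD (phi_character H x)).
- move=> s t; apply: cleP => x; rewrite psi_mapE eps_meet.
  have [_ _ phiI _] := phi_map_hom H.
  by have := congr1 (fun g => cval g x) (phiI (eps s) (eps t)).
- move=> s t; apply: cleP => x; rewrite psi_mapE eps_join.
  have [_ _ _ phiU] := phi_map_hom H.
  by have := congr1 (fun g => cval g x) (phiU (eps s) (eps t)).
- by apply: cleP => x; rewrite psi_mapE eps_rho (ch_scal (phi_character H x)).
- move=> a b a' b' ha hb; apply: cleP => x.
  rewrite -[RHS]/(cle_val (sval a') x * cle_val (sval b') x) -ha -hb !psi_mapE.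
  by rewrite eps_mul (chM (phi_character H x)).
- move=> r s r0; apply: cleP => x.
  by rewrite cle_val_act // !psi_mapE eps_act // (chZ (phi_character H x)).
Defined.

End Psi.

Section Zeta.
Variable X : nach.

Lemma env_inclE (f g : Cle R X) : env_incl (eps f - eps g) = sval f - sval g.
Proof. by apply: (@env_ext_sub R (Cle R X) (CX R X) (fun f => sval f)). Qed.

Lemma env_incl_eps (f : Cle R X) : env_incl (eps f) = sval f.
Proof.
rewrite -[eps f]subr0 -eps0 env_inclE; apply: CX_ext => x.
by rewrite cvalB subr0.
Qed.

Lemma env_incl_hom : is_latalg_hom (@env_incl R X).
Proof.
apply: (@env_ext_hom R (Cle R X) (CX R X) _ (nbal_ordered (CX_nbal R X))
  (fun f => sval f)) => //.
by move=> r f r0; apply: CX_ext => x; exact: cle_val_act.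
Qed.

Lemma env_incl_inj (x : envelope (Cle R X)) : env_incl x = 0 -> x = 0.
Proof.
have [f [g ->]] := env_subP x; rewrite env_inclE => /eqP; rewrite subr_eq0.
move=> /eqP fg; have -> : f = g by apply: cleP => z; rewrite /cle_val fg.
exact: subrr.
Qed.

Lemma env_incl_homo (x : envelope (Cle R X)) :
  env_prec x x -> order_preserving (env_incl x).
Proof. by move=> /env_prec_refl[f ->]; rewrite env_incl_eps; exact: svalP. Qed.

Lemma env_incl_full (f : CX R X) : order_preserving f ->
  exists2 x : envelope (Cle R X), env_prec x x & env_incl x = f.
Proof.
move=> hf; exists (eps (exist _ f hf : Cle R X)); last exact: env_incl_eps.
by apply/env_prec_refl; exists (exist _ f hf).
Qed.

Definition zeta_hom : nach_hom X (spec_sbal (Cle R X)) :=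
  eval_hom (env_ordered (Cle R X)) env_incl_hom env_incl_homo.

Lemma zeta_hom_iso : @is_iso Nachcat _ _ zeta_hom.
Proof. by apply: eval_hom_iso; [exact: env_incl_inj|exact: env_incl_full]. Qed.

Lemma phi_zeta (f : Cle R X) (x : X) :
  phi_val (eps f) (zeta_hom x) = cle_val f x.
Proof.
by rewrite [LHS](phi_eval_point (env_ordered (Cle R X))) env_incl_eps.
Qed.

End Zeta.

Definition Cle_functor : @contrafunctor Nachcat (sbalcat R) (Cle R).
Proof.
apply: (@Contrafunctor Nachcat (sbalcat R) _ (fun X Z u => cle_pullback_hom u)).
  by move=> X; apply: sbal_hom_ext => f; exact: cleP.
by move=> X Y Z g f; apply: sbal_hom_ext => h; exact: cleP.
Defined.

Lemma phi_spec_sbal (S T : sbal R) (f : sbal_hom S T) s x :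
  phi_val (eps s) (spec_sbal_hom f x) = phi_val (eps (f s)) x.
Proof.
by rewrite [LHS](phi_spec_map (env_ordered S)) env_map_eps.
Qed.

Definition Y_functor : @contrafunctor (sbalcat R) Nachcat (fun S => spec_sbal S).
Proof.
apply: (@Contrafunctor (sbalcat R) Nachcat _ (fun S T f => spec_sbal_hom f)).
  move=> S; apply: nach_hom_ext => x; apply: spec_eps_ext => s.
  exact: phi_spec_sbal.
move=> S T U g f; apply: nach_hom_ext => x; apply: spec_eps_ext => s.
rewrite [LHS]phi_spec_sbal.
by rewrite [RHS]phi_spec_sbal [RHS]phi_spec_sbal.
Defined.

Lemma sbal_adjunction :
  contravariant_adjunction Cle_functor Y_functor psi_hom zeta_hom.
Proof.
split.
- move=> S T f; apply: sbal_hom_ext => s; apply: cleP => x.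
  by rewrite [RHS]phi_spec_sbal.
- move=> X Y u; apply: nach_hom_ext => x; apply: spec_eps_ext => g.
  by rewrite [LHS]phi_zeta [RHS]phi_spec_sbal [RHS]phi_zeta.
- by move=> X; apply: sbal_hom_ext => g; apply: cleP => x; exact: phi_zeta.
- move=> S; apply: nach_hom_ext => x; apply: spec_eps_ext => s.
  by rewrite [LHS]phi_spec_sbal phi_zeta.
Qed.

End SbalAdjunction.

Theorem theorem5p12 (R : realType) :
  (exists (hC : forall X : nach, nbal_axioms (@CX_prec R X))
          (hX : forall A : nbal R, nachbin_axioms (spec_le (@nbal_prec R A)))
          (C : @contrafunctor Nachcat (nbalcat R) (fun X => Nbal (hC X)))
          (X : @contrafunctor (nbalcat R) Nachcat (fun A => Nach (hX A)))
          (phi : forall A : nbal R, nbal_hom A (Nbal (hC (Nach (hX A)))))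
          (eta : forall X : nach, nach_hom X (Nach (hX (Nbal (hC X))))),
    [/\ forall (Y Z : nach) (f : nach_hom Y Z) (g : CX R Z) (y : Y),
          cval ((C Y Z f : nbal_hom _ _) g) y = cval g (f y),
        forall (A B : nbal R) (alpha : nbal_hom A B) (y : spec B),
          sval ((X A B alpha : nach_hom _ _) y) = alpha @^-1` sval y,
        (forall A : nbal R, spec_closed_sets A) /\
        (forall (A : nbal R) (a : A) (x : spec A),
          (exists! r : R, residue_at a x r) /\
          cval (phi A a) x = phi_val a x),
        forall (Y : nach) (y : Y),
          sval (eta Y y) = [set f : CX R Y | cval f y = 0]
      & contravariant_adjunction C X phi eta /\
        forall Y : nach, @is_iso Nachcat _ _ (eta Y)])
  /\
  (exists (hY : forall S : sbal R, nachbin_axioms (spec_le (@env_prec R S)))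
          (C : @contrafunctor Nachcat (sbalcat R) (Cle R))
          (Y : @contrafunctor (sbalcat R) Nachcat (fun S => Nach (hY S)))
          (psi : forall S : sbal R, sbal_hom S (Cle R (Nach (hY S))))
          (zeta : forall X : nach, nach_hom X (Nach (hY (Cle R X)))),
    [/\ forall (X Z : nach) (f : nach_hom X Z) (g : Cle R Z) (x : X),
          cle_val ((C X Z f : sbal_hom _ _) g) x = cle_val g (f x),
        forall (S T : sbal R) (alpha : sbal_hom S T) (y : spec (envelope T)),
          sval ((Y S T alpha : nach_hom _ _) y) = env_map alpha @^-1` sval y,
        (forall S : sbal R, spec_closed_sets (envelope S)) /\
        (forall (S : sbal R) (s : S) (x : spec (envelope S)),
          (exists! r : R, residue_at (eps s) x r) /\
          cle_val (psi S s) x = phi_val (eps s) x),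
        forall (X : nach) (x : X),
          sval (zeta X x) = @env_incl R X @^-1` [set f : CX R X | cval f x = 0]
      & contravariant_adjunction C Y psi zeta /\
        forall X : nach, @is_iso Nachcat _ _ (zeta X)]).
Proof.
split.
  exists (@CX_nbal_axioms R), (fun A => spec_nachbin (nbal_ordered A)),
    (C_functor R), (X_functor R), (@phi_nbal R), (@eta_nbal R).
  split=> //.
  - by move=> A B f y; exact: (spec_mapE (nbal_ordered B)).
  - split=> [A|A a x]; first exact: spec_closedP (nbal_ordered A).
    by split=> //; exact: residue_exuniq (nbal_ordered A) _ _.
  - by split; [exact: nbal_adjunction|exact: eta_nbal_iso].
exists (fun S => spec_nachbin (env_ordered S)), (Cle_functor R), (Y_functor R),
  (@psi_hom R), (@zeta_hom R).
split=> //.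
- by move=> S T f y; exact: (spec_mapE (env_ordered T)).
- split=> [S|S s x]; first exact: spec_closedP (env_ordered S).
  by split=> //; exact: residue_exuniq (env_ordered S) _ _.
- by split; [exact: sbal_adjunction|exact: zeta_hom_iso].
Qed.
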